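(* Let $d = 2$ and $w_{ij} = 1$ for all $i,j$. For $\varepsilon > 0$ and $\tau \in (-1,1)$ define $\varphi_{\varepsilon,\tau}(t) = \varepsilon \log\!\big(1 + e^{(t-\tau)/\varepsilon}\big)$; it is real-analytic with $\varphi_{\varepsilon,\tau}'(t) > 0$ and $\varphi_{\varepsilon,\tau}''(t) > 0$ for all $t$. There exist $\varepsilon > 0$ and $\tau \in (-1,1)$ such that, for every $n \geq 5$, the gradient flow $\dot X = \mathrm{grad} f(X)$ of $f(X) = \frac12 \sum_{i,j=1}^n \varphi_{\varepsilon,\tau}(x_i^\top x_j)$ on $(\mathbb{S}^1)^n$, started from a uniformly random initial point, converges with positive probability to a local maximum of $f$ which is not synchronized (i.e., not all $x_i$ equal).
   Context: $(\mathbb{S}^1)^n$ is the set of $X \in \mathbb{R}^{2\times n}$ with unit-norm columns $x_1,\dots,x_n$, a Riemannian submanifold of $\mathbb{R}^{2 \times n}$ with the Frobenius metric; $\mathrm{grad}$ is the Riemannian gradient. *)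

(* Defs.v *)
From Stdlib Require Import Reals.
From Coquelicot Require Import Coquelicot.
Open Scope R_scope.

Definition pt := (R * R)%type.
Definition dot (u v : pt) : R := fst u * fst v + snd u * snd v.

(* A configuration X in R^{2 x n}: column i is X i (only i < n is relevant). *)
Definition cfg := nat -> pt.

Definition on_torus (n : nat) (X : cfg) : Prop :=
  forall i, (i < n)%nat -> dot (X i) (X i) = 1.

Fixpoint sumR (n : nat) (g : nat -> R) : R :=
  match n with O => 0 | S m => sumR m g + g m end.
Fixpoint prodR (n : nat) (g : nat -> R) : R :=
  match n with O => 1 | S m => prodR m g * g m end.

Definition phi (eps tau t : R) : R := eps * ln (1 + exp ((t - tau) / eps)).

Definition fobj (eps tau : R) (n : nat) (X : cfg) : R :=
  / 2 * sumR n (fun i => sumR n (fun j => phi eps tau (dot (X i) (X j)))).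

Definition upd (X : cfg) (i : nat) (p : pt) : cfg :=
  fun k => if Nat.eqb k i then p else X k.

Definition egrad (eps tau : R) (n : nat) (X : cfg) : cfg :=
  fun i =>
    (Derive (fun s => fobj eps tau n (upd X i (s, snd (X i)))) (fst (X i)),
     Derive (fun s => fobj eps tau n (upd X i (fst (X i), s))) (snd (X i))).

(* Riemannian gradient on the Riemannian submanifold (S^1)^n of R^{2 x n}
   (Frobenius metric): orthogonal projection of the Euclidean gradient onto
   the tangent space, column-wise v_i - (x_i^T v_i) x_i. *)
Definition rgrad (eps tau : R) (n : nat) (X : cfg) : cfg :=
  fun i =>
    let v := egrad eps tau n X i in
    let c := dot v (X i) in
    (fst v - c * fst (X i), snd v - c * snd (X i)).

Definition is_flow (eps tau : R) (n : nat) (X0 : cfg) (X : R -> cfg) : Prop :=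
  (forall i, (i < n)%nat -> X 0 i = X0 i) /\
  (forall t, 0 <= t -> on_torus n (X t)) /\
  (forall i, (i < n)%nat ->
     filterlim (fun t => fst (X t i)) (at_right 0) (locally (fst (X0 i))) /\
     filterlim (fun t => snd (X t i)) (at_right 0) (locally (snd (X0 i)))) /\
  (forall t i, 0 < t -> (i < n)%nat ->
     is_derive (fun s => fst (X s i)) t (fst (rgrad eps tau n (X t) i)) /\
     is_derive (fun s => snd (X s i)) t (snd (rgrad eps tau n (X t) i))).

Definition converges_to (n : nat) (X : R -> cfg) (Xs : cfg) : Prop :=
  forall i, (i < n)%nat ->
    is_lim (fun t => fst (X t i)) p_infty (fst (Xs i)) /\
    is_lim (fun t => snd (X t i)) p_infty (snd (Xs i)).

Definition is_local_max (eps tau : R) (n : nat) (Xs : cfg) : Prop :=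
  on_torus n Xs /\
  exists delta, 0 < delta /\
    forall Y, on_torus n Y ->
      (forall i, (i < n)%nat ->
         Rabs (fst (Y i) - fst (Xs i)) < delta /\
         Rabs (snd (Y i) - snd (Xs i)) < delta) ->
      fobj eps tau n Y <= fobj eps tau n Xs.

Definition synchronized (n : nat) (X : cfg) : Prop :=
  forall i j, (i < n)%nat -> (j < n)%nat -> X i = X j.

Definition good_init (eps tau : R) (n : nat) (X0 : cfg) : Prop :=
  on_torus n X0 /\
  (exists X, is_flow eps tau n X0 X) /\
  (forall X, is_flow eps tau n X0 X ->
     exists Xs, converges_to n X Xs /\ is_local_max eps tau n Xs /\
                ~ synchronized n Xs).

(* Angle parametrization theta |-> ((cos theta_i, sin theta_i))_i of (S^1)^n;
   the uniform probability on (S^1)^n is the push-forward of normalized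
   Lebesgue measure on [0, 2 pi)^n. *)
Definition ang (theta : nat -> R) : cfg := fun i => (cos (theta i), sin (theta i)).

Definition leb_null (n : nat) (A : (nat -> R) -> Prop) : Prop :=
  forall e, 0 < e ->
    exists lo hi : nat -> nat -> R,
      (forall k i, (i < n)%nat -> lo k i <= hi k i) /\
      (forall theta, A theta ->
         exists k, forall i, (i < n)%nat -> lo k i <= theta i <= hi k i) /\
      (forall K, sumR K (fun k => prodR n (fun i => hi k i - lo k i)) <= e).

(* A subset S of (S^1)^n has positive (outer) probability under the uniform
   measure iff its angle preimage is not Lebesgue-null. *)
Definition pos_prob (n : nat) (S : cfg -> Prop) : Prop :=
  ~ leb_null n (fun theta => S (ang theta)).

(* Main.v *)
Require Import Defs.
From Stdlib Require Import Reals Lra Lia Classical ClassicalEpsilon.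
From Coquelicot Require Import Coquelicot.
Open Scope R_scope.

(** In angle coordinates the flow is [th_i' = sum_j h'(th_i - th_j)] with [h = phi o cos].
    As [eps -> 0] a pair attracts with force [sin] when its cosine exceeds [tau] and does not
    interact otherwise, so [h''] is clearly negative on close pairs (for [tau > 0]) and
    negligible on distant ones, and [f] is strongly concave modulo rotations as long as the
    graph of close pairs is well connected.  Then the squared norm [W] of the force decays
    exponentially along the flow, and a trajectory that starts where [W] is small compared with
    the concavity constant stays in the region and converges to a critical point, which is a
    local maximum.

    It remains to find, for every [n >= 5], a configuration with small force.  For [n < N] take
    the regular [n]-gon, where the force vanishes; its pairs have cosine at least
    [sin (PI / (2 N))] or at most [0], so [tau = sin (PI / (2 N)) / 2] separates them for all
    these [n] at once.  For [n >= N] put point [i] at [2 PI i / 5]: the five clusters are almost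
    balanced, each force is at most [4], and the concavity constant grows linearly in [n], so a
    suitable [N] depending only on the pentagon works.  Finally [eps] is chosen small depending
    on [N]. *)

(** No single family of configurations serves all [n]. The positive cosines in a regular [n]-gon
    come arbitrarily close to 0 as [n] grows, while [eps] and [tau] must not depend on [n]; the
    pentagon clusters leave an unbalanced force, which the concavity beats only for large [n].
    Joining the two ranges puts [tau] below the gap of the [N]-gon, hence possibly very close to 0,
    so the clusters must tolerate every small positive [tau]. The pentagon does: its cosines avoid
    the open interval between [- sin (PI / 10)] and [sin (PI / 10)]. Its box radius and concavity
    constant therefore depend on neither [tau] nor [eps], and choosing [N] from them is not
    circular.

    Rotation invariance makes every critical point degenerate. This is harmless because the forces
    sum to zero: the velocity is orthogonal to the rotation direction, so concavity in the remaining
    directions already gives exponential decay. The trajectory then has finite length, and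
    convergence to a single point follows without any compactness argument. *)

(** * Finite sums and one-variable estimates *)

Lemma sumR_ext n f g : (forall i, (i < n)%nat -> f i = g i) -> sumR n f = sumR n g.
Proof.
  induction n as [|n IH]; intros H; simpl; [reflexivity|].
  rewrite IH, H; auto with arith.
Qed.

Lemma sumR_plus n f g : sumR n (fun i => f i + g i) = sumR n f + sumR n g.
Proof. induction n as [|n IH]; simpl; [ring|rewrite IH; ring]. Qed.

Lemma sumR_scal n a f : sumR n (fun i => a * f i) = a * sumR n f.
Proof. induction n as [|n IH]; simpl; [ring|rewrite IH; ring]. Qed.

Lemma sumR_opp n f : sumR n (fun i => - f i) = - sumR n f.
Proof. induction n as [|n IH]; simpl; [ring|rewrite IH; ring]. Qed.

Lemma sumR_le n f g : (forall i, (i < n)%nat -> f i <= g i) -> sumR n f <= sumR n g.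
Proof.
  induction n as [|n IH]; intros H; simpl; [lra|].
  apply Rplus_le_compat; auto with arith.
Qed.

Lemma sumR_const n a : sumR n (fun _ => a) = INR n * a.
Proof. induction n as [|n IH]; [simpl; ring|]. rewrite S_INR; simpl; rewrite IH; ring. Qed.

Lemma sumR_0 n f : (forall i, (i < n)%nat -> f i = 0) -> sumR n f = 0.
Proof. intros H. rewrite (sumR_ext n f (fun _ => 0)), sumR_const by auto. ring. Qed.

Lemma sumR_nonneg n f : (forall i, (i < n)%nat -> 0 <= f i) -> 0 <= sumR n f.
Proof.
  intros H. replace 0 with (sumR n (fun _ => 0)) by (rewrite sumR_const; ring).
  now apply sumR_le.
Qed.

Lemma sumR_abs n f : Rabs (sumR n f) <= sumR n (fun i => Rabs (f i)).
Proof.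
  induction n as [|n IH]; simpl; [rewrite Rabs_R0; lra|].
  eapply Rle_trans; [apply Rabs_triang|lra].
Qed.

Lemma sumR_abs_le n f a :
  (forall i, (i < n)%nat -> Rabs (f i) <= a) -> Rabs (sumR n f) <= INR n * a.
Proof.
  intros H. rewrite <- sumR_const. eapply Rle_trans; [apply sumR_abs|].
  now apply sumR_le.
Qed.

Lemma sumR_swap n m (f : nat -> nat -> R) :
  sumR n (fun i => sumR m (fun j => f i j)) = sumR m (fun j => sumR n (fun i => f i j)).
Proof.
  induction n as [|n IH]; simpl.
  - symmetry; now apply sumR_0.
  - now rewrite IH, sumR_plus.
Qed.

Lemma sumR_term_le n f i :
  (forall k, (k < n)%nat -> 0 <= f k) -> (i < n)%nat -> f i <= sumR n f.
Proof.
  induction n as [|n IH]; intros H Hi; [lia|]. simpl.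
  destruct (Nat.eq_dec i n) as [->|Hne].
  - pose proof (sumR_nonneg n f). assert (0 <= sumR n f) by auto with arith. lra.
  - assert (f i <= sumR n f) by (apply IH; [auto with arith|lia]).
    specialize (H n). assert (0 <= f n) by auto. lra.
Qed.

Lemma sumR_kronecker n i g :
  (i < n)%nat -> sumR n (fun a => if Nat.eqb a i then g a else 0) = g i.
Proof.
  induction n as [|n IH]; intros Hi; [lia|]. simpl.
  destruct (Nat.eq_dec i n) as [->|Hne].
  - rewrite Nat.eqb_refl, sumR_0; [ring|].
    intros k Hk. replace (Nat.eqb k n) with false; [easy|].
    symmetry; apply Nat.eqb_neq; lia.
  - replace (Nat.eqb n i) with false by (symmetry; apply Nat.eqb_neq; lia).
    rewrite IH by lia. ring.
Qed.

Lemma sumR_split n m f : sumR (n + m) f = sumR n f + sumR m (fun j => f (n + j)%nat).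
Proof.
  induction m as [|m IH]; [rewrite Nat.add_0_r; simpl; ring|].
  rewrite Nat.add_succ_r; simpl. rewrite IH; ring.
Qed.

(** Averages a double sum with its transpose. With [h1] odd and [h2] even, this turns sums weighted
    by [v i] into sums weighted by [v i - v j]. *)
Lemma sumR_symmetrize n (g k : nat -> nat -> R) :
  (forall i j, (i < n)%nat -> (j < n)%nat -> g i j + g j i = k i j) ->
  2 * sumR n (fun i => sumR n (fun j => g i j)) = sumR n (fun i => sumR n (fun j => k i j)).
Proof.
  intros H.
  replace (2 * _) with (sumR n (fun i => sumR n (fun j => g i j))
                        + sumR n (fun j => sumR n (fun i => g i j))) by (rewrite <- sumR_swap; ring).
  rewrite <- sumR_plus. apply sumR_ext; intros i Hi.
  rewrite <- sumR_plus. apply sumR_ext; intros j Hj. auto.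
Qed.

Lemma is_derive_sumR n (f : nat -> R -> R) (d : nat -> R) x :
  (forall i, (i < n)%nat -> is_derive (f i) x (d i)) ->
  is_derive (fun s => sumR n (fun i => f i s)) x (sumR n d).
Proof.
  induction n as [|n IH]; intros H; simpl.
  - apply @is_derive_const.
  - apply (is_derive_plus (fun s => sumR n (fun i => f i s)) (f n)); auto with arith.
Qed.

Lemma continuous_sumR n (f : nat -> R -> R) x :
  (forall i, (i < n)%nat -> continuous (f i) x) ->
  continuous (fun s => sumR n (fun i => f i s)) x.
Proof.
  induction n as [|n IH]; intros H; simpl.
  - apply continuous_const.
  - apply (continuous_plus (fun s => sumR n (fun i => f i s)) (f n)); auto with arith.
Qed.

Lemma is_derive_eq (f : R -> R) (x l l' : R) : is_derive f x l -> l = l' -> is_derive f x l'.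
Proof. now intros H <-. Qed.

Lemma is_derive_continuity_pt (f : R -> R) (x l : R) : is_derive f x l -> continuity_pt f x.
Proof.
  intros H. apply continuity_pt_filterlim, (ex_derive_continuous f). now exists l.
Qed.

Lemma derive_le_decreasing (f df : R -> R) a b :
  a <= b -> (forall x, a <= x <= b -> is_derive f x (df x)) ->
  (forall x, a <= x <= b -> df x <= 0) -> f b <= f a.
Proof.
  intros Hab Hd Hn.
  destruct (MVT_gen f a b df) as [c [Hc Heq]];
    rewrite ?Rmin_left, ?Rmax_right in * by lra.
  - intros x Hx; apply Hd; lra.
  - intros x Hx. eapply is_derive_continuity_pt, Hd; lra.
  - specialize (Hn c Hc). nra.
Qed.

Lemma derive_bound_lipschitz (f df : R -> R) L :
  (forall x, is_derive f x (df x)) -> (forall x, Rabs (df x) <= L) ->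
  forall x y, Rabs (f x - f y) <= L * Rabs (x - y).
Proof.
  intros Hd Hb x y.
  destruct (MVT_gen f y x df) as [c [_ Heq]].
  - intros; apply Hd.
  - intros z _; eapply is_derive_continuity_pt, Hd.
  - rewrite Heq, Rabs_mult. apply Rmult_le_compat_r; [apply Rabs_pos|apply Hb].
Qed.

(** * The pair potential *)

(** The logistic function, which is the derivative of [phi]. Its own derivative [ddphi] is written
    through the logistic equation, so that it is small as soon as [dphi] is close enough to 0 or
    1. *)
Definition dphi (eps tau t : R) : R := / (1 + exp (- ((t - tau) / eps))).
Definition ddphi (eps tau t : R) : R := dphi eps tau t * (1 - dphi eps tau t) / eps.

(** [h1] and [h2] are the first two derivatives of [phi eps tau (cos x)] in the angle [x]. *)
Definition h1 (eps tau x : R) : R := - (dphi eps tau (cos x) * sin x).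
Definition h2 (eps tau x : R) : R :=
  ddphi eps tau (cos x) * (sin x * sin x) - dphi eps tau (cos x) * cos x.

Lemma dphi_range eps tau t : 0 < dphi eps tau t < 1.
Proof.
  unfold dphi. pose proof (exp_pos (- ((t - tau) / eps))) as He. split.
  - apply Rinv_0_lt_compat; lra.
  - rewrite <- Rinv_1. apply Rinv_lt_contravar; lra.
Qed.

Lemma ddphi_range eps tau t : 0 < eps -> 0 < ddphi eps tau t <= / eps.
Proof.
  intros He. unfold ddphi. pose proof (dphi_range eps tau t).
  assert (0 < / eps) by now apply Rinv_0_lt_compat.
  unfold Rdiv. split; [apply Rmult_lt_0_compat; nra|].
  assert (dphi eps tau t * (1 - dphi eps tau t) <= 1) by nra. nra.
Qed.

Lemma is_derive_phi eps tau t : 0 < eps -> is_derive (phi eps tau) t (dphi eps tau t).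
Proof.
  intros He. unfold phi, dphi.
  pose proof (exp_pos ((t - tau) / eps)) as Hp.
  auto_derive; unfold Rminus, Rdiv in *; [lra|].
  rewrite exp_Ropp. field. split; lra.
Qed.

Lemma is_derive_dphi eps tau t : 0 < eps -> is_derive (dphi eps tau) t (ddphi eps tau t).
Proof.
  intros He. unfold ddphi, dphi.
  pose proof (exp_pos (- ((t - tau) / eps))) as Hp.
  auto_derive; [unfold Rminus, Rdiv in *; lra|].
  unfold Rminus, Rdiv in *. field. split; lra.
Qed.

Lemma is_derive_h1 eps tau x : 0 < eps -> is_derive (h1 eps tau) x (h2 eps tau x).
Proof.
  intros He. unfold h1, h2.
  pose proof (is_derive_dphi eps tau (cos x) He) as Hd.
  auto_derive.
  - now exists (ddphi eps tau (cos x)).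
  - replace (Derive _ _) with (ddphi eps tau (cos x)); [ring|]. symmetry; now apply is_derive_unique.
Qed.

Lemma is_derive_phi_cos eps tau x :
  0 < eps -> is_derive (fun y => phi eps tau (cos y)) x (h1 eps tau x).
Proof.
  intros He. unfold h1.
  pose proof (is_derive_phi eps tau (cos x) He) as Hd.
  auto_derive.
  - now exists (dphi eps tau (cos x)).
  - replace (Derive _ _) with (dphi eps tau (cos x)); [ring|]. symmetry; now apply is_derive_unique.
Qed.

Lemma h1_bound eps tau x : Rabs (h1 eps tau x) <= 1.
Proof.
  unfold h1. rewrite Rabs_Ropp, Rabs_mult.
  pose proof (dphi_range eps tau (cos x)). pose proof (SIN_bound x).
  rewrite (Rabs_pos_eq (dphi _ _ _)) by lra.
  assert (Rabs (sin x) <= 1) by (apply Rabs_le; lra).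
  pose proof (Rabs_pos (sin x)). nra.
Qed.

Lemma h2_bound eps tau x : 0 < eps -> Rabs (h2 eps tau x) <= / eps + 1.
Proof.
  intros He. unfold h2.
  pose proof (dphi_range eps tau (cos x)). pose proof (ddphi_range eps tau (cos x) He).
  pose proof (COS_bound x). pose proof (sin2_cos2 x) as Hsc. unfold Rsqr in Hsc.
  assert (0 <= sin x * sin x <= 1) by nra.
  apply Rabs_le; split; nra.
Qed.

Lemma h1_odd eps tau x : h1 eps tau (- x) = - h1 eps tau x.
Proof. unfold h1. rewrite cos_neg, sin_neg. ring. Qed.

Lemma h2_even eps tau x : h2 eps tau (- x) = h2 eps tau x.
Proof. unfold h2. rewrite cos_neg, sin_neg. ring. Qed.

Lemma h1_lipschitz eps tau x y :
  0 < eps -> Rabs (h1 eps tau x - h1 eps tau y) <= (/ eps + 1) * Rabs (x - y).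
Proof.
  intros He. apply derive_bound_lipschitz with (df := h2 eps tau); intros.
  - now apply is_derive_h1.
  - now apply h2_bound.
Qed.

(** * The Riemannian gradient in angle coordinates *)

Definition force (eps tau : R) (n : nat) (th : nat -> R) (i : nat) : R :=
  sumR n (fun j => h1 eps tau (th i - th j)).

Definition wedge (u v : pt) : R := fst u * snd v - snd u * fst v.

(** The angular velocity of column [i] under the gradient flow: on the unit circle [wedge u v] is
    the sine of the angle from [u] to [v]. *)
Definition omega (eps tau : R) (n : nat) (X : cfg) (i : nat) : R :=
  sumR n (fun j => dphi eps tau (dot (X i) (X j)) * wedge (X i) (X j)).

Lemma dot_comm u v : dot u v = dot v u.
Proof. unfold dot; ring. Qed.

(** Treats both partial derivatives at once: [p] moves one coordinate of column [i], and [c] is the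
    linear form ([fst] or [snd]) that this motion induces on inner products. *)
Lemma is_derive_fobj_coord eps tau n X i (p : R -> pt) (s0 : R) (c : pt -> R) :
  0 < eps -> (i < n)%nat -> p s0 = X i ->
  (forall v : pt, is_derive (fun s => dot (p s) v) s0 (c v)) ->
  is_derive (fun s => dot (p s) (p s)) s0 (2 * c (X i)) ->
  is_derive (fun s => fobj eps tau n (upd X i (p s))) s0
    (sumR n (fun j => dphi eps tau (dot (X i) (X j)) * c (X j))).
Proof.
  intros He Hi Hp Hc Hcc.
  assert (Hk : forall k, upd X i (p s0) k = X k).
  { intros k. unfold upd. destruct (Nat.eqb_spec k i) as [->|]; auto. }
  (* The pair [(a, b)] varies through its row when [a = i] and through its column when [b = i]; the
     diagonal pair gets both. By symmetry the two contributions have the same sum, which cancels the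
     factor [/ 2] in [fobj]. *)
  set (d := fun a b => (if Nat.eqb a i then dphi eps tau (dot (X i) (X b)) * c (X b) else 0)
                     + (if Nat.eqb b i then dphi eps tau (dot (X i) (X a)) * c (X a) else 0)).
  assert (Hd : forall a b, is_derive
     (fun s => phi eps tau (dot (upd X i (p s) a) (upd X i (p s) b))) s0 (d a b)).
  { intros a b.
    assert (Hin : is_derive (fun s => dot (upd X i (p s) a) (upd X i (p s) b)) s0
       ((if Nat.eqb a i then c (X b) else 0) + (if Nat.eqb b i then c (X a) else 0))).
    { unfold upd. destruct (Nat.eqb_spec a i) as [->|Ha]; destruct (Nat.eqb_spec b i) as [->|Hb].
      - eapply is_derive_eq; [exact Hcc|ring].
      - eapply is_derive_eq; [apply Hc|ring].
      - eapply is_derive_eq; [|].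
        + eapply is_derive_ext; [|apply (Hc (X a))]. intros t; apply dot_comm.
        + ring.
      - eapply is_derive_eq; [apply @is_derive_const|]. unfold zero; simpl; ring. }
    eapply is_derive_eq.
    - apply (is_derive_comp (phi eps tau)
               (fun s => dot (upd X i (p s) a) (upd X i (p s) b))); [|exact Hin].
      apply is_derive_phi, He.
    - rewrite !Hk. unfold d, scal; simpl; unfold mult; simpl.
      destruct (Nat.eqb_spec a i) as [Ha|Ha]; destruct (Nat.eqb_spec b i) as [Hb|Hb];
        rewrite ?Ha, ?Hb, ?(dot_comm (X i) (X a)); ring. }
  unfold fobj.
  eapply is_derive_eq.
  - apply (is_derive_scal (fun s => sumR n (fun a => sumR n (fun b =>
       phi eps tau (dot (upd X i (p s) a) (upd X i (p s) b)))))).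
    apply (is_derive_sumR n (fun a s => sumR n (fun b =>
       phi eps tau (dot (upd X i (p s) a) (upd X i (p s) b))))
       (fun a => sumR n (fun b => d a b))).
    intros a Ha. apply (is_derive_sumR n (fun b s =>
       phi eps tau (dot (upd X i (p s) a) (upd X i (p s) b)))). intros b Hb; apply Hd.
  - unfold d. set (g := fun b => dphi eps tau (dot (X i) (X b)) * c (X b)).
    rewrite (sumR_ext n _ (fun a => (if Nat.eqb a i then sumR n g else 0) + g a)).
    + rewrite sumR_plus, (sumR_kronecker n i (fun _ => sumR n g) Hi). field.
    + intros a Ha. unfold g.
      rewrite sumR_plus, (sumR_kronecker n i
        (fun _ => dphi eps tau (dot (X i) (X a)) * c (X a)) Hi).
      destruct (Nat.eqb a i); [reflexivity|]. now rewrite sumR_0.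
Qed.

Lemma egrad_eq eps tau n X i : 0 < eps -> (i < n)%nat ->
  egrad eps tau n X i =
    (sumR n (fun j => dphi eps tau (dot (X i) (X j)) * fst (X j)),
     sumR n (fun j => dphi eps tau (dot (X i) (X j)) * snd (X j))).
Proof.
  intros He Hi. unfold egrad. f_equal; apply is_derive_unique.
  - apply (is_derive_fobj_coord eps tau n X i (fun s => (s, snd (X i))) _ fst); auto.
    + now destruct (X i).
    + intros v; unfold dot; simpl. auto_derive; [easy|ring].
    + unfold dot; simpl. auto_derive; [easy|ring].
  - apply (is_derive_fobj_coord eps tau n X i (fun s => (fst (X i), s)) _ snd); auto.
    + now destruct (X i).
    + intros v; unfold dot; simpl. auto_derive; [easy|ring].
    + unfold dot; simpl. auto_derive; [easy|ring].
Qed.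

(** For a unit vector [x], projecting [y] onto the tangent line at [x] leaves [wedge x y] times the
    quarter turn of [x]. In particular the diagonal terms drop out. *)
Lemma rgrad_eq eps tau n X i : 0 < eps -> (i < n)%nat -> dot (X i) (X i) = 1 ->
  rgrad eps tau n X i =
    (- snd (X i) * omega eps tau n X i, fst (X i) * omega eps tau n X i).
Proof.
  intros He Hi H1. unfold rgrad.
  pose (a := fun j => dphi eps tau (dot (X i) (X j))).
  change (omega eps tau n X i) with (sumR n (fun j => a j * wedge (X i) (X j))).
  replace (egrad eps tau n X i)
    with (sumR n (fun j => a j * fst (X j)), sumR n (fun j => a j * snd (X j)))
    by (symmetry; now apply egrad_eq).
  assert (Hdot : dot (sumR n (fun j => a j * fst (X j)), sumR n (fun j => a j * snd (X j))) (X i)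
                 = sumR n (fun j => a j * dot (X i) (X j))).
  { unfold dot at 1; simpl. rewrite (Rmult_comm (sumR _ _)), (Rmult_comm (sumR _ _) (snd (X i))).
    rewrite <- !sumR_scal, <- sumR_plus. apply sumR_ext; intros j _. unfold dot; ring. }
  cbv zeta. rewrite Hdot.
  rewrite (Rmult_comm _ (fst (X i))), (Rmult_comm _ (snd (X i))).
  unfold Rminus. rewrite !Ropp_mult_distr_l, <- !sumR_scal. simpl fst; simpl snd.
  rewrite <- !sumR_plus.
  unfold dot in H1.
  f_equal; apply sumR_ext; intros j _; unfold wedge, dot;
    destruct (X i) as [x y], (X j) as [x' y']; simpl in *.
  - replace x' with (x' * (x * x + y * y)) at 1 by (rewrite H1; ring). ring.
  - replace y' with (y' * (x * x + y * y)) at 1 by (rewrite H1; ring). ring.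
Qed.

Lemma omega_ang eps tau n th i : omega eps tau n (ang th) i = force eps tau n th i.
Proof.
  unfold omega, force, h1, wedge, dot, ang; simpl. apply sumR_ext; intros j _.
  rewrite cos_minus, sin_minus. ring.
Qed.

Lemma omega_ext eps tau n X Y i :
  (i < n)%nat -> (forall k, (k < n)%nat -> X k = Y k) ->
  omega eps tau n X i = omega eps tau n Y i.
Proof. intros Hi H. apply sumR_ext; intros j Hj. now rewrite !H. Qed.

Lemma ang_on_torus n th : on_torus n (ang th).
Proof.
  intros i _. unfold dot, ang; simpl.
  pose proof (sin2_cos2 (th i)) as H. unfold Rsqr in H. lra.
Qed.

(* The velocity is frozen at negative times, so that solutions are differentiable on
   all of [R] and no one-sided derivative at [0] is needed. *)
Definition angle_flow (eps tau : R) (n : nat) (th0 : nat -> R) (th : R -> nat -> R) : Prop :=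
  (forall i, (i < n)%nat -> th 0 i = th0 i) /\
  (forall t i, (i < n)%nat ->
     is_derive (fun s => th s i) t (force eps tau n (th (Rmax t 0)) i)).

Lemma angle_flow_is_flow eps tau n th0 th :
  0 < eps -> angle_flow eps tau n th0 th ->
  is_flow eps tau n (ang th0) (fun t => ang (th t)).
Proof.
  intros He [H0 Hd].
  assert (Hc : forall t i, (i < n)%nat -> continuous (fun s => th s i) t).
  { intros t i Hi. apply (ex_derive_continuous (fun s => th s i)). eexists; now apply Hd. }
  split; [|split; [|split]].
  - intros i Hi. unfold ang. now rewrite H0.
  - intros t _. apply ang_on_torus.
  - intros i Hi. unfold ang; simpl. rewrite <- !(H0 i Hi). split.
    + eapply (filterlim_filter_le_1 (F := locally 0)).
      * intros P HP. unfold at_right, within. revert HP; now apply filter_imp.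
      * apply (continuous_comp (fun s => th s i) cos); [auto|apply continuous_cos].
    + eapply (filterlim_filter_le_1 (F := locally 0)).
      * intros P HP. unfold at_right, within. revert HP; now apply filter_imp.
      * apply (continuous_comp (fun s => th s i) sin); [auto|apply continuous_sin].
  - intros t i Ht Hi.
    rewrite rgrad_eq by (auto; apply ang_on_torus with (n := n); auto).
    rewrite omega_ang. specialize (Hd t i Hi). rewrite Rmax_left in Hd by lra.
    unfold ang; simpl.
    split; eapply is_derive_eq.
    + apply (is_derive_comp cos (fun s => th s i)); [|exact Hd].
      apply is_derive_Reals, derivable_pt_lim_cos.
    + unfold scal; simpl; unfold mult; simpl; ring.
    + apply (is_derive_comp sin (fun s => th s i)); [|exact Hd].
      apply is_derive_Reals, derivable_pt_lim_sin.
    + unfold scal; simpl; unfold mult; simpl; ring.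
Qed.

(** Freezing [f] at negative times upgrades its right-continuity at 0, all that [is_flow] provides
    there, to continuity on the whole line, as the integrals require. *)
Lemma continuous_Rmax_0 (f : R -> R) t :
  (forall s, 0 < s -> continuous f s) ->
  filterlim f (at_right 0) (locally (f 0)) -> continuous (fun s => f (Rmax s 0)) t.
Proof.
  intros Hp H0.
  destruct (Rtotal_order t 0) as [Hn|[->|Ht]].
  - apply continuous_ext_loc with (fun _ => f 0); [|apply continuous_const].
    exists (mkposreal (- t) ltac:(lra)). intros s Hs.
    assert (s < 0). { revert Hs. unfold ball; simpl; unfold AbsRing_ball, abs, minus, plus, opp; simpl.
      intros Hs; apply Rabs_def2 in Hs; lra. }
    now rewrite Rmax_right by lra.
  - unfold continuous. rewrite Rmax_left by lra. intros P HP.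
    specialize (H0 P HP). pose proof (locally_singleton _ _ HP) as HP0.
    unfold filtermap, at_right, within in *. revert H0. apply filter_imp. intros s Hs.
    destruct (Rle_dec s 0) as [Hle|Hgt].
    + now rewrite Rmax_right.
    + rewrite Rmax_left by lra. apply Hs; lra.
  - apply continuous_ext_loc with f; [|now apply Hp].
    exists (mkposreal t Ht). intros s Hs.
    assert (0 < s). { revert Hs. unfold ball; simpl; unfold AbsRing_ball, abs, minus, plus, opp; simpl.
      intros Hs; apply Rabs_def2 in Hs; lra. }
    now rewrite Rmax_left by lra.
Qed.

Lemma is_derive_primitive (f : R -> R) a t :
  (forall s, continuous f s) -> is_derive (fun s => a + RInt f 0 s) t (f t).
Proof.
  intros Hc. eapply is_derive_eq.
  - apply (is_derive_plus (fun _ => a) (fun s => RInt f 0 s)).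
    + apply @is_derive_const.
    + apply is_derive_RInt with 0; [|apply Hc].
      apply filter_forall. intros s. apply (RInt_correct (V := R_CompleteNormedModule)), ex_RInt_continuous.
      intros; apply Hc.
  - unfold plus, zero; simpl; ring.
Qed.

(* The angular velocity of a flow on the torus integrates to a lift of the flow:
   both [X] and the lift rotate with the same velocity and start at the same point. *)
Lemma flow_lift eps tau n th0 X :
  0 < eps -> is_flow eps tau n (ang th0) X ->
  exists th, angle_flow eps tau n th0 th /\
    forall t i, 0 <= t -> (i < n)%nat -> X t i = ang (th t) i.
Proof.
  intros He (H0 & Ht & Hr & Hd).
  set (Xe := fun t => X (Rmax t 0)).
  assert (Hcx : forall t i, (i < n)%nat -> continuous (fun s => fst (Xe s i)) t).
  { intros t i Hi. apply (continuous_Rmax_0 (fun s => fst (X s i))).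
    - intros s Hs. apply (ex_derive_continuous (fun s => fst (X s i))).
      eexists; now apply (Hd s i).
    - rewrite (H0 i Hi). now apply Hr. }
  assert (Hcy : forall t i, (i < n)%nat -> continuous (fun s => snd (Xe s i)) t).
  { intros t i Hi. apply (continuous_Rmax_0 (fun s => snd (X s i))).
    - intros s Hs. apply (ex_derive_continuous (fun s => snd (X s i))).
      eexists; now apply (Hd s i).
    - rewrite (H0 i Hi). now apply Hr. }
  assert (Hco : forall i, (i < n)%nat -> forall t, continuous (fun s => omega eps tau n (Xe s) i) t).
  { intros i Hi t. unfold omega. apply continuous_sumR. intros j Hj. unfold dot, wedge.
    apply @continuous_mult.
    - apply (continuous_comp (fun s => fst (Xe s i) * fst (Xe s j) + snd (Xe s i) * snd (Xe s j))
               (dphi eps tau)).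
      + apply @continuous_plus; apply @continuous_mult; auto.
      + apply (ex_derive_continuous (dphi eps tau)). eexists; now apply is_derive_dphi.
    - apply @continuous_minus; apply @continuous_mult; auto. }
  set (th := fun t i => th0 i + RInt (fun s => omega eps tau n (Xe s) i) 0 t).
  assert (Hdt : forall t i, (i < n)%nat ->
            is_derive (fun s => th s i) t (omega eps tau n (Xe t) i)).
  { intros t i Hi. apply (is_derive_primitive (fun s => omega eps tau n (Xe s) i)). auto. }
  assert (Hth0 : forall i, th 0 i = th0 i).
  { intros i. unfold th. rewrite RInt_point. unfold zero; simpl; ring. }
  assert (Hu : forall t i, 0 <= t -> (i < n)%nat -> dot (Xe t i) (ang (th t) i) = 1).
  { intros t i Hpos Hi.
    assert (Hcu : forall s, continuous (fun s => dot (Xe s i) (ang (th s) i)) s).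
    { intros s. unfold dot, ang; simpl.
      assert (continuous (fun s => th s i) s).
      { apply (ex_derive_continuous (fun s => th s i)). eexists; now apply Hdt. }
      apply @continuous_plus; apply @continuous_mult; auto.
      - apply (continuous_comp (fun s => th s i) cos); [auto|apply continuous_cos].
      - apply (continuous_comp (fun s => th s i) sin); [auto|apply continuous_sin]. }
    assert (Hst : dot (Xe 0 i) (ang (th 0) i) = 1).
    { unfold Xe. rewrite Rmax_left by lra. rewrite H0 by assumption.
      replace (ang (th 0) i) with (ang th0 i) by (unfold ang; now rewrite Hth0).
      now apply (ang_on_torus n). }
    destruct (MVT_gen (fun s => dot (Xe s i) (ang (th s) i)) 0 t (fun _ => 0)) as [c [_ Hm]].
    - intros s Hs. rewrite Rmin_left, Rmax_right in Hs by lra.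
      destruct (Hd s i (proj1 Hs) Hi) as [Hx Hy].
      assert (Hos : dot (X s i) (X s i) = 1) by (apply (Ht s); [lra|assumption]).
      rewrite (rgrad_eq eps tau n (X s) i He Hi Hos) in Hx, Hy. simpl in Hx, Hy.
      assert (HXs : Xe s = X s) by (unfold Xe; now rewrite Rmax_left by lra).
      apply is_derive_ext_loc with (fun s => dot (X s i) (ang (th s) i)).
      { exists (mkposreal s (proj1 Hs)). intros z Hz. unfold Xe.
        rewrite Rmax_left; [reflexivity|]. revert Hz.
        unfold ball; simpl; unfold AbsRing_ball, abs, minus, plus, opp; simpl.
        intros Hz; apply Rabs_def2 in Hz; lra. }
      unfold dot, ang; simpl.
      specialize (Hdt s i Hi). rewrite HXs in Hdt.
      set (w := omega eps tau n (X s) i) in *.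
      assert (Hcs : is_derive (fun s => cos (th s i)) s (- sin (th s i) * w)).
      { eapply is_derive_eq.
        - apply (is_derive_comp cos (fun s => th s i)); [|exact Hdt].
          apply is_derive_Reals, derivable_pt_lim_cos.
        - unfold scal; simpl; unfold mult; simpl; ring. }
      assert (Hsn : is_derive (fun s => sin (th s i)) s (cos (th s i) * w)).
      { eapply is_derive_eq.
        - apply (is_derive_comp sin (fun s => th s i)); [|exact Hdt].
          apply is_derive_Reals, derivable_pt_lim_sin.
        - unfold scal; simpl; unfold mult; simpl; ring. }
      eapply is_derive_eq.
      + apply (is_derive_plus (fun s => fst (X s i) * cos (th s i))
                 (fun s => snd (X s i) * sin (th s i))).
        * apply (is_derive_mult (fun s => fst (X s i)) (fun s => cos (th s i)));
            [exact Hx|exact Hcs|intros; apply Rmult_comm].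
        * apply (is_derive_mult (fun s => snd (X s i)) (fun s => sin (th s i)));
            [exact Hy|exact Hsn|intros; apply Rmult_comm].
      + unfold plus, mult; simpl. ring.
    - intros s _. apply continuity_pt_filterlim, Hcu.
    - lra. }
  assert (Heq : forall t i, 0 <= t -> (i < n)%nat -> Xe t i = ang (th t) i).
  { intros t i Hpos Hi. specialize (Hu t i Hpos Hi).
    assert (H1 : dot (Xe t i) (Xe t i) = 1).
    { unfold Xe. apply Ht; [apply Rmax_r|assumption]. }
    pose proof (ang_on_torus n (th t) i Hi) as H2.
    destruct (Xe t i) as [x y], (ang (th t) i) as [x' y']. unfold dot in *; simpl in *.
    (* The squared distance of two unit vectors is 2 minus twice their inner product, which was just
       shown to be 1. *)
    assert (Hz : (x - x') * (x - x') + (y - y') * (y - y') = 0) by lra.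
    pose proof (Rle_0_sqr (x - x')) as Hx. pose proof (Rle_0_sqr (y - y')) as Hy.
    unfold Rsqr in Hx, Hy.
    f_equal; apply Rminus_diag_uniq, Rsqr_0_uniq; unfold Rsqr; lra. }
  exists th. split; [split|].
  - intros i Hi. apply Hth0.
  - intros t i Hi. eapply is_derive_eq; [now apply Hdt|].
    rewrite <- omega_ang. apply omega_ext; [assumption|].
    intros k Hk. rewrite <- Heq by (auto; apply Rmax_r).
    unfold Xe. now rewrite (Rmax_left (Rmax t 0) 0) by apply Rmax_r.
  - intros t i Hpos Hi. rewrite <- Heq by assumption. unfold Xe. now rewrite Rmax_left.
Qed.

(** * Global solvability of Lipschitz systems *)

Lemma lipschitz_continuous (f : R -> R) L x :
  (forall y z, Rabs (f y - f z) <= L * Rabs (y - z)) -> continuous f x.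
Proof.
  intros HL. apply continuity_pt_filterlim. intros e He.
  pose proof (Rabs_pos L) as HLp. pose proof (Rle_abs L) as HLa.
  exists (e / (Rabs L + 1)). split; [apply Rdiv_lt_0_compat; lra|].
  intros y [_ Hy]. simpl in *. unfold Rdist in *.
  apply Rle_lt_trans with ((Rabs L + 1) * Rabs (y - x)).
  - eapply Rle_trans; [apply HL|]. pose proof (Rabs_pos (y - x)). nra.
  - apply Rmult_lt_compat_l with (r := Rabs L + 1) in Hy; [|lra].
    replace ((Rabs L + 1) * (e / (Rabs L + 1))) with e in Hy by (field; lra). exact Hy.
Qed.

(** Compares [f] and [- f] with the majorant [A * exp (c * x)], whose derivative is the assumed
    bound. Integrating an exponential of rate [c] thus gains a factor [/ c], the source of the
    contraction in the Picard iteration. *)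
Lemma exp_growth (f df : R -> R) A c t :
  0 <= t -> 0 <= A -> f 0 = 0 ->
  (forall x, 0 <= x <= t -> is_derive f x (df x)) ->
  (forall x, 0 <= x <= t -> Rabs (df x) <= A * c * exp (c * x)) ->
  Rabs (f t) <= A * exp (c * t).
Proof.
  intros Ht HA H0 Hd Hb.
  assert (He : forall x, is_derive (fun x => A * exp (c * x)) x (A * c * exp (c * x))).
  { intros x. auto_derive; [easy|ring]. }
  apply Rabs_le; split.
  - assert (- f t - A * exp (c * t) <= - f 0 - A * exp (c * 0)) as H.
    { apply (derive_le_decreasing (fun x => - f x - A * exp (c * x))
               (fun x => - df x - A * c * exp (c * x))); [lra| |].
      - intros x Hx. apply (is_derive_minus (fun x => - f x)); [|apply He].
        apply (is_derive_opp f); auto.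
      - intros x Hx. specialize (Hb x Hx). apply Rabs_le_between in Hb. lra. }
    rewrite H0, Rmult_0_r, exp_0 in H. lra.
  - assert (f t - A * exp (c * t) <= f 0 - A * exp (c * 0)) as H.
    { apply (derive_le_decreasing (fun x => f x - A * exp (c * x))
               (fun x => df x - A * c * exp (c * x))); [lra| |].
      - intros x Hx. apply (is_derive_minus f); [auto|apply He].
      - intros x Hx. specialize (Hb x Hx). apply Rabs_le_between in Hb. lra. }
    rewrite H0, Rmult_0_r, exp_0 in H. lra.
Qed.

Lemma le_geom_nonpos x A : (forall k, x <= A * (/ 2) ^ k) -> x <= 0.
Proof.
  intros H.
  assert (Hl : is_lim_seq (fun k => A * (/ 2) ^ k) (A * 0)).
  { apply (is_lim_seq_scal_l _ A 0). apply is_lim_seq_geom. rewrite Rabs_pos_eq; lra. }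
  rewrite Rmult_0_r in Hl.
  apply (is_lim_seq_le (fun _ => x) (fun k => A * (/ 2) ^ k) x 0 H); [apply is_lim_seq_const|exact Hl].
Qed.

Lemma geom_cauchy_lim (u : nat -> R) A :
  (forall k, Rabs (u (S k) - u k) <= A * (/ 2) ^ k) ->
  is_lim_seq u (real (Lim_seq u)) /\
  forall k, Rabs (u k - real (Lim_seq u)) <= 2 * A * (/ 2) ^ k.
Proof.
  intros H.
  assert (HA : 0 <= A). { specialize (H 0%nat). pose proof (Rabs_pos (u 1%nat - u 0%nat)). simpl in H. lra. }
  (* The partial geometric sum is kept exactly, through the factor [1 - (/ 2) ^ m], so that the
     induction on [m] closes. *)
  assert (Hm : forall k m, Rabs (u k - u (k + m)%nat) <= 2 * A * (/ 2) ^ k * (1 - (/ 2) ^ m)).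
  { intros k m. induction m as [|m IH].
    - rewrite Nat.add_0_r, Rminus_diag, Rabs_R0. simpl. lra.
    - rewrite Nat.add_succ_r. replace (u k - u (S (k + m)))
        with ((u k - u (k + m)%nat) - (u (S (k + m)) - u (k + m)%nat)) by ring.
      eapply Rle_trans; [apply Rabs_triang|]. rewrite Rabs_Ropp.
      specialize (H (k + m)%nat). rewrite pow_add in H. simpl.
      assert (0 <= A * ((/ 2) ^ k * (/ 2) ^ m)).
      { apply Rmult_le_pos; [easy|]. apply Rmult_le_pos; apply pow_le; lra. }
      nra. }
  assert (Hm' : forall k m, Rabs (u k - u (k + m)%nat) <= 2 * A * (/ 2) ^ k).
  { intros k m. eapply Rle_trans; [apply Hm|].
    assert (0 <= (/ 2) ^ m) by (apply pow_le; lra).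
    assert (0 <= A * (/ 2) ^ k) by (apply Rmult_le_pos; [easy|apply pow_le; lra]). nra. }
  assert (Hex : ex_finite_lim_seq u).
  { apply ex_lim_seq_cauchy_corr. intros e.
    assert (Hl : is_lim_seq (fun k => 4 * A * (/ 2) ^ k) (4 * A * 0)).
    { apply (is_lim_seq_scal_l _ (4 * A) 0). apply is_lim_seq_geom. rewrite Rabs_pos_eq; lra. }
    rewrite Rmult_0_r in Hl. apply is_lim_seq_spec in Hl.
    destruct (Hl e) as [N HN]. exists N. intros p q Hp Hq.
    specialize (HN N (Nat.le_refl N)).
    pose proof (Hm' N (p - N)%nat) as H1. pose proof (Hm' N (q - N)%nat) as H2.
    replace (N + (p - N))%nat with p in H1 by lia.
    replace (N + (q - N))%nat with q in H2 by lia.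
    replace (u p - u q) with ((u N - u q) - (u N - u p)) by ring.
    eapply Rle_lt_trans; [apply Rabs_triang|]. rewrite Rabs_Ropp.
    rewrite Rminus_0_r in HN. apply Rabs_def2 in HN. lra. }
  assert (Hl : is_lim_seq u (real (Lim_seq u))).
  { apply Lim_seq_correct' in Hex. exact Hex. }
  split; [exact Hl|]. intros k.
  apply (is_lim_seq_le (fun m => Rabs (u k - u (m + k)%nat)) (fun _ => 2 * A * (/ 2) ^ k)
           (Rabs (u k - Lim_seq u)) (2 * A * (/ 2) ^ k)).
  - intros m. rewrite Nat.add_comm. apply Hm'.
  - apply (is_lim_seq_abs _ (u k - Lim_seq u)).
    apply is_lim_seq_minus'; [apply is_lim_seq_const|].
    now apply (is_lim_seq_incr_n u k).
  - apply is_lim_seq_const.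
Qed.

Fixpoint picard (G : (nat -> R) -> nat -> R) (x0 : nat -> R) (k : nat) (t : R) (i : nat) : R :=
  match k with
  | O => x0 i
  | S k => x0 i + RInt (fun s => G (picard G x0 k s) i) 0 t
  end.

(* The Picard iterates converge geometrically for the weight [exp (2 K t)]. *)
Lemma ode_exists (n : nat) (G : (nat -> R) -> nat -> R) (K B : R) (x0 : nat -> R) :
  1 <= K ->
  (forall x i, (i < n)%nat -> Rabs (G x i) <= B) ->
  (forall x y d, (forall j, (j < n)%nat -> Rabs (x j - y j) <= d) ->
     forall i, (i < n)%nat -> Rabs (G x i - G y i) <= K * d) ->
  exists th : R -> nat -> R,
    (forall i, (i < n)%nat -> th 0 i = x0 i) /\
    (forall t i, (i < n)%nat -> is_derive (fun s => th s i) t (G (th (Rmax t 0)) i)).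
Proof.
  intros HK HB HL.
  (* Every iterate is [B]-Lipschitz in time, and this bound survives the limit. It makes the
     integrands continuous without a separate uniform convergence argument. *)
  assert (Hcomp : forall u : R -> nat -> R,
    (forall j, (j < n)%nat -> forall s t, Rabs (u s j - u t j) <= B * Rabs (s - t)) ->
    forall i, (i < n)%nat -> forall t, continuous (fun s => G (u s) i) t).
  { intros u Hu i Hi t. apply lipschitz_continuous with (K * B). intros y z.
    rewrite Rmult_assoc. apply HL; [|assumption]. intros j Hj. now apply Hu. }
  assert (Hprim : forall u : R -> nat -> R,
    (forall j, (j < n)%nat -> forall s t, Rabs (u s j - u t j) <= B * Rabs (s - t)) ->
    forall i, (i < n)%nat -> forall t,
      is_derive (fun t => x0 i + RInt (fun s => G (u s) i) 0 t) t (G (u t) i)).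
  { intros u Hu i Hi t. apply (is_derive_primitive (fun s => G (u s) i)). now apply Hcomp. }
  set (p := picard G x0).
  assert (HB0 : forall i, (i < n)%nat -> 0 <= B).
  { intros i Hi. eapply Rle_trans; [apply Rabs_pos|apply (HB x0 i Hi)]. }
  assert (Hlip : forall k i, (i < n)%nat -> forall s t,
            Rabs (p k s i - p k t i) <= B * Rabs (s - t)).
  { induction k as [|k IH]; intros i Hi s t.
    - simpl. rewrite Rminus_diag, Rabs_R0.
      apply Rmult_le_pos; [now apply HB0 with i|apply Rabs_pos].
    - apply (derive_bound_lipschitz (fun t => p (S k) t i) (fun t => G (p k t) i)).
      + intros x. apply (Hprim (p k)); auto.
      + intros x. now apply HB. }
  assert (Hder : forall k i, (i < n)%nat -> forall t,
            is_derive (fun t => p (S k) t i) t (G (p k t) i)).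
  { intros k i Hi t. apply (Hprim (p k)); auto. }
  assert (Hp0 : forall k i, p k 0 i = x0 i).
  { intros [|k] i; [reflexivity|]. unfold p; simpl. rewrite RInt_point.
    unfold zero; simpl; ring. }
  (* Each step loses the factor [K] from the Lipschitz bound and gains [/ (2 * K)] from the weight,
     hence the ratio [/ 2]. *)
  assert (Hgeo : forall k t i, 0 <= t -> (i < n)%nat ->
            Rabs (p (S k) t i - p k t i) <= B * exp (2 * K * t) * (/ 2) ^ k).
  { induction k as [|k IH]; intros t i Ht Hi.
    - rewrite pow_O, Rmult_1_r.
      apply (exp_growth (fun t => p 1%nat t i - p 0%nat t i) (fun t => G (p 0%nat t) i) B (2 * K));
        auto.
      + eauto using HB0.
      + rewrite !Hp0; ring.
      + intros x Hx. eapply is_derive_eq.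
        * apply (is_derive_minus (fun t => p 1%nat t i) (fun t => x0 i)).
          -- apply Hder, Hi.
          -- apply @is_derive_const.
        * unfold minus, plus, opp, zero; simpl; ring.
      + intros x Hx. eapply Rle_trans; [now apply HB|].
        pose proof (HB0 i Hi). pose proof (exp_ineq1_le (2 * K * x)).
        assert (0 <= K * x) by nra. assert (1 <= K * exp (2 * K * x)) by nra. nra.
    - replace (B * exp (2 * K * t) * (/ 2) ^ S k)
        with (B * (/ 2) ^ S k * exp (2 * K * t)) by ring.
      apply (exp_growth (fun t => p (S (S k)) t i - p (S k) t i)
               (fun t => G (p (S k) t) i - G (p k t) i)); auto.
      + apply Rmult_le_pos; [eauto using HB0|apply pow_le; lra].
      + rewrite !Hp0; ring.
      + intros x Hx. apply (is_derive_minus (fun t => p (S (S k)) t i) (fun t => p (S k) t i));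
          now apply Hder.
      + intros x Hx. replace (B * (/ 2) ^ S k * (2 * K) * exp (2 * K * x))
          with (K * (B * exp (2 * K * x) * (/ 2) ^ k)) by (simpl; field).
        apply HL; [|assumption]. intros j Hj. apply IH; [lra|assumption]. }
  set (v := fun t i => real (Lim_seq (fun k => p k (Rmax t 0) i))).
  assert (Hv : forall t i, (i < n)%nat ->
     is_lim_seq (fun k => p k (Rmax t 0) i) (v t i) /\
     forall k, Rabs (p k (Rmax t 0) i - v t i) <= 2 * (B * exp (2 * K * Rmax t 0)) * (/ 2) ^ k).
  { intros t i Hi. apply (geom_cauchy_lim (fun k => p k (Rmax t 0) i)).
    intros k. apply Hgeo; [apply Rmax_r|assumption]. }
  assert (Hvl : forall j, (j < n)%nat -> forall s t, Rabs (v s j - v t j) <= B * Rabs (s - t)).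
  { intros j Hj s t.
    apply (is_lim_seq_le (fun k => Rabs (p k (Rmax s 0) j - p k (Rmax t 0) j))
             (fun _ => B * Rabs (s - t)) (Rabs (v s j - v t j)) (B * Rabs (s - t))).
    - intros k. eapply Rle_trans; [now apply Hlip|].
      apply Rmult_le_compat_l; [eauto using HB0|].
      unfold Rmax; destruct (Rle_dec s 0), (Rle_dec t 0); split_Rabs; lra.
    - apply (is_lim_seq_abs _ (v s j - v t j)). apply is_lim_seq_minus'; now apply Hv.
    - apply is_lim_seq_const. }
  (* [w] applies the integral operator to the pointwise limit [v]. It is differentiable by
     construction, and equals [v] at nonnegative times because both are the limit of the same
     iterates. *)
  set (w := fun t i => x0 i + RInt (fun s => G (v s) i) 0 t).
  assert (Hw0 : forall i, w 0 i = x0 i).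
  { intros i. unfold w. rewrite RInt_point. unfold zero; simpl; ring. }
  assert (Hdw : forall i, (i < n)%nat -> forall t, is_derive (fun t => w t i) t (G (v t) i)).
  { intros i Hi t. now apply (Hprim v). }
  assert (Hwv : forall t i, 0 <= t -> (i < n)%nat -> w t i = v t i).
  { intros t i Ht Hi. apply Rminus_diag_uniq.
    assert (Rabs (w t i - v t i) <= 0).
    { apply le_geom_nonpos with (2 * (B * exp (2 * K * t))). intros k.
      assert (H1 : Rabs (w t i - p (S k) t i) <= B * (/ 2) ^ k * exp (2 * K * t)).
      { apply (exp_growth (fun t => w t i - p (S k) t i) (fun t => G (v t) i - G (p k t) i)); auto.
        - apply Rmult_le_pos; [eauto using HB0|apply pow_le; lra].
        - rewrite Hw0, Hp0; ring.
        - intros x Hx. apply (is_derive_minus (fun t => w t i) (fun t => p (S k) t i));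
            [now apply Hdw|now apply Hder].
        - intros x Hx. replace (B * (/ 2) ^ k * (2 * K) * exp (2 * K * x))
            with (K * (2 * (B * exp (2 * K * x)) * (/ 2) ^ k)) by ring.
          apply HL; [|assumption]. intros j Hj. rewrite Rabs_minus_sym.
          destruct (Hv x j Hj) as [_ H]. rewrite Rmax_left in H by lra. apply H. }
      destruct (Hv t i Hi) as [_ H2]. specialize (H2 (S k)). rewrite Rmax_left in H2 by lra.
      replace (w t i - v t i) with ((w t i - p (S k) t i) + (p (S k) t i - v t i)) by ring.
      eapply Rle_trans; [apply Rabs_triang|]. simpl in H2. lra. }
    pose proof (Rabs_pos (w t i - v t i)). apply Rabs_eq_0. lra. }
  exists w. split; [auto|].
  intros t i Hi. eapply is_derive_eq; [now apply Hdw|].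
  apply Rminus_diag_uniq, Rabs_eq_0, Rle_antisym; [|apply Rabs_pos].
  apply Rle_trans with (K * 0); [|lra]. apply HL; [|assumption]. intros j Hj.
  rewrite Hwv by (auto; apply Rmax_r). unfold v.
  rewrite (Rmax_left (Rmax t 0) 0) by apply Rmax_r. rewrite Rminus_diag, Rabs_R0. lra.
Qed.

Lemma force_bound eps tau n th i : Rabs (force eps tau n th i) <= INR n.
Proof.
  rewrite <- (Rmult_1_r (INR n)). apply sumR_abs_le. intros; apply h1_bound.
Qed.

Lemma force_lipschitz eps tau n x y d i :
  0 < eps -> (forall j, (j < n)%nat -> Rabs (x j - y j) <= d) -> (i < n)%nat ->
  Rabs (force eps tau n x i - force eps tau n y i) <= INR n * (2 * (/ eps + 1) * d).
Proof.
  intros He H Hi. unfold force, Rminus. rewrite <- sumR_opp, <- sumR_plus.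
  apply sumR_abs_le. intros j Hj.
  eapply Rle_trans; [now apply h1_lipschitz|].
  assert (0 < / eps) by now apply Rinv_0_lt_compat.
  assert (Rabs (x i - x j - (y i - y j)) <= 2 * d).
  { replace (x i - x j - (y i - y j)) with ((x i - y i) - (x j - y j)) by ring.
    eapply Rle_trans; [apply Rabs_triang|]. rewrite Rabs_Ropp.
    pose proof (H i Hi). pose proof (H j Hj). lra. }
  unfold Rminus in *. nra.
Qed.

Lemma angle_flow_exists eps tau n th0 : 0 < eps -> exists th, angle_flow eps tau n th0 th.
Proof.
  intros He. pose proof (pos_INR n) as Hn.
  assert (0 < / eps) by now apply Rinv_0_lt_compat.
  set (K := INR n * (2 * (/ eps + 1)) + 1).
  destruct (ode_exists n (force eps tau n) K (INR n) th0) as (th & H0 & Hd).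
  - unfold K. nra.
  - intros; apply force_bound.
  - intros x y d Hd i Hi. eapply Rle_trans; [apply force_lipschitz with (d := d); auto|].
    assert (0 <= d) by (eapply Rle_trans; [apply Rabs_pos|apply (Hd i Hi)]).
    unfold K. nra.
  - exists th. now split.
Qed.

(** * Exponential convergence in a region of concavity *)

Definition in_box (n : nat) (b : nat -> R) (r : R) (th : nat -> R) : Prop :=
  forall i, (i < n)%nat -> Rabs (th i - b i) <= r.

Definition dispersion (n : nat) (v : nat -> R) : R :=
  sumR n (fun i => sumR n (fun j => (v i - v j) ^ 2)).

Definition hessian (eps tau : R) (n : nat) (th v : nat -> R) : R :=
  sumR n (fun i => sumR n (fun j => h2 eps tau (th i - th j) * (v i - v j) ^ 2)).

(* Strong concavity modulo rotations; [hessian] is twice the Hessian form of [fobj]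
   in angle coordinates. *)
Definition concave_on_box (eps tau : R) (n : nat) (b : nat -> R) (r mu : R) : Prop :=
  forall th, in_box n b r th ->
  forall v, hessian eps tau n th v <= - mu * dispersion n v.

Definition energy (eps tau : R) (n : nat) (th : nat -> R) : R :=
  sumR n (fun i => force eps tau n th i ^ 2).

Lemma dispersion_nonneg n v : 0 <= dispersion n v.
Proof. apply sumR_nonneg; intros i _. apply sumR_nonneg; intros j _. apply pow2_ge_0. Qed.

(** Meant for [v] the force, which has sum zero by rotation invariance. It converts concavity modulo
    rotations into a decay rate [2 * mu * INR n] for the energy, a rate that grows with [n]. *)
Lemma dispersion_mean_zero n v :
  sumR n v = 0 -> dispersion n v = 2 * INR n * sumR n (fun i => v i ^ 2).
Proof.
  intros H. set (Q := sumR n (fun i => v i ^ 2)).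
  unfold dispersion. rewrite (sumR_ext n _ (fun i => INR n * v i ^ 2 + Q)).
  - rewrite sumR_plus, sumR_scal, sumR_const. fold Q. ring.
  - intros i Hi.
    rewrite (sumR_ext n _ (fun j => (v i ^ 2 + v j ^ 2) + (- 2 * v i) * v j)) by (intros; ring).
    rewrite !sumR_plus, sumR_const, sumR_scal, H. fold Q. ring.
Qed.

Lemma force_sum eps tau n th : sumR n (force eps tau n th) = 0.
Proof.
  assert (H : 2 * sumR n (force eps tau n th) = sumR n (fun i => sumR n (fun j => 0))).
  { unfold force. apply sumR_symmetrize. intros i j _ _.
    replace (th j - th i) with (- (th i - th j)) by ring. rewrite h1_odd. ring. }
  rewrite (sumR_0 n (fun _ => sumR n _)) in H; [lra|]. intros; now apply sumR_0.
Qed.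

Lemma is_derive_force eps tau n (th : R -> nat -> R) (w : nat -> R) t i :
  0 < eps -> (forall j, (j < n)%nat -> is_derive (fun s => th s j) t (w j)) -> (i < n)%nat ->
  is_derive (fun s => force eps tau n (th s) i) t
    (sumR n (fun j => h2 eps tau (th t i - th t j) * (w i - w j))).
Proof.
  intros He Hw Hi. unfold force.
  apply (is_derive_sumR n (fun j s => h1 eps tau (th s i - th s j))).
  intros j Hj. eapply is_derive_eq.
  - apply (is_derive_comp (h1 eps tau) (fun s => th s i - th s j)).
    + now apply is_derive_h1.
    + apply (is_derive_minus (fun s => th s i) (fun s => th s j)); now apply Hw.
  - unfold scal, minus, plus, opp; simpl; unfold mult; simpl. ring.
Qed.

(** The velocity is the force itself, so differentiating its squared norm evaluates the Hessian form
    in the direction of the force. *)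
Lemma is_derive_energy eps tau n (th : R -> nat -> R) t :
  0 < eps ->
  (forall j, (j < n)%nat -> is_derive (fun s => th s j) t (force eps tau n (th t) j)) ->
  is_derive (fun s => energy eps tau n (th s)) t
    (hessian eps tau n (th t) (force eps tau n (th t))).
Proof.
  intros He Hw. set (F := force eps tau n (th t)).
  set (dF := fun i => sumR n (fun j => h2 eps tau (th t i - th t j) * (F i - F j))).
  eapply is_derive_eq.
  - apply (is_derive_sumR n (fun i s => force eps tau n (th s) i ^ 2)
             (fun i => 2 * (F i * dF i))).
    intros i Hi. eapply is_derive_eq.
    + apply (is_derive_pow (fun s => force eps tau n (th s) i) 2).
      apply is_derive_force; [assumption|exact Hw|assumption].
    + fold F. fold (dF i). simpl. ring.
  - rewrite sumR_scal. unfold hessian, dF.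
    rewrite (sumR_ext n (fun i => F i * _) (fun i => sumR n (fun j =>
               F i * (h2 eps tau (th t i - th t j) * (F i - F j)))))
      by (intros; now rewrite sumR_scal).
    apply sumR_symmetrize. intros i j _ _.
    replace (th t j - th t i) with (- (th t i - th t j)) by ring. rewrite h2_even. ring.
Qed.

Lemma exp_decay_small C lam e :
  0 <= C -> 0 < lam -> 0 < e ->
  exists T, 0 <= T /\ forall t, T <= t -> C * exp (- (lam * t)) < e.
Proof.
  intros HC Hl He. exists (C / (e * lam)).
  assert (Hel : 0 < e * lam) by nra.
  split; [apply Rmult_le_pos; [easy|]; left; now apply Rinv_0_lt_compat|].
  intros t Ht. rewrite exp_Ropp.
  assert (HT : C <= e * lam * t).
  { apply Rmult_le_compat_l with (r := e * lam) in Ht; [|lra].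
    replace (e * lam * (C / (e * lam))) with C in Ht by (field; lra). lra. }
  pose proof (exp_ineq1_le (lam * t)) as H1. pose proof (exp_pos (lam * t)) as H2.
  apply Rmult_lt_reg_r with (exp (lam * t)); [easy|].
  rewrite Rmult_assoc, Rinv_l, Rmult_1_r by lra. nra.
Qed.

Lemma exp_cauchy_limit (f : R -> R) C lam :
  0 <= C -> 0 < lam ->
  (forall s t, 0 <= s <= t -> Rabs (f t - f s) <= C * exp (- (lam * s))) ->
  exists l, forall t, 0 <= t -> Rabs (f t - l) <= C * exp (- (lam * t)).
Proof.
  intros HC Hl H.
  assert (Hex : ex_finite_lim_seq (fun k => f (INR k))).
  { apply ex_lim_seq_cauchy_corr. intros e.
    destruct (exp_decay_small (2 * C) lam e) as (T & HT & HTs); [lra|easy|apply cond_pos|].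
    destruct (INR_unbounded T) as [N HN]. exists N. intros p q Hp Hq.
    apply le_INR in Hp, Hq.
    pose proof (H (INR N) (INR p) ltac:(lra)) as H1.
    pose proof (H (INR N) (INR q) ltac:(lra)) as H2.
    specialize (HTs (INR N) ltac:(lra)).
    replace (f (INR p) - f (INR q))
      with ((f (INR p) - f (INR N)) - (f (INR q) - f (INR N))) by ring.
    eapply Rle_lt_trans; [apply Rabs_triang|]. rewrite Rabs_Ropp. lra. }
  apply Lim_seq_correct' in Hex. set (l := real (Lim_seq _)) in Hex.
  exists l. intros t Ht. rewrite Rabs_minus_sym.
  apply (is_lim_seq_le_loc (fun k => Rabs (f (INR k) - f t)) (fun _ => C * exp (- (lam * t)))
           (Rabs (l - f t)) (C * exp (- (lam * t)))).
  - destruct (INR_unbounded t) as [N HN]. exists N. intros k Hk. apply H.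
    apply le_INR in Hk. lra.
  - apply (is_lim_seq_abs _ (l - f t)). apply is_lim_seq_minus'; [exact Hex|apply is_lim_seq_const].
  - apply is_lim_seq_const.
Qed.

Lemma exp_cauchy_is_lim (f : R -> R) l C lam :
  0 <= C -> 0 < lam -> (forall t, 0 <= t -> Rabs (f t - l) <= C * exp (- (lam * t))) ->
  is_lim f p_infty l.
Proof.
  intros HC Hl H. apply is_lim_spec. intros e.
  destruct (exp_decay_small C lam e) as (T & HT & HTs); [easy|easy|apply cond_pos|].
  exists T. intros t Ht. eapply Rle_lt_trans; [apply H; lra|apply HTs; lra].
Qed.

Lemma energy_decay eps tau n b r mu th0 th T :
  0 < eps -> concave_on_box eps tau n b r mu -> angle_flow eps tau n th0 th ->
  (forall s, 0 <= s <= T -> in_box n b r (th s)) ->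
  forall t, 0 <= t <= T ->
    energy eps tau n (th t) <= energy eps tau n (th 0) * exp (- (2 * (mu * INR n) * t)).
Proof.
  intros He Hcv [_ Hd] Hbox t Ht. set (c := 2 * (mu * INR n)).
  assert (H : energy eps tau n (th t) * exp (c * t) <= energy eps tau n (th 0) * exp (c * 0)).
  { apply (derive_le_decreasing (fun s => energy eps tau n (th s) * exp (c * s))
      (fun s => (hessian eps tau n (th s) (force eps tau n (th s))
                 + c * energy eps tau n (th s)) * exp (c * s))); [lra| |].
    - intros s Hs. eapply is_derive_eq.
      + apply (is_derive_mult (fun s => energy eps tau n (th s)) (fun s => exp (c * s))).
        * apply is_derive_energy; [assumption|]. intros j Hj.
          specialize (Hd s j Hj). rewrite Rmax_left in Hd by lra. exact Hd.
        * instantiate (1 := c * exp (c * s)). auto_derive; [easy|ring].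
        * intros; apply Rmult_comm.
      + unfold plus, mult; simpl. ring.
    - intros s Hs. pose proof (exp_pos (c * s)).
      pose proof (Hcv (th s) (Hbox s ltac:(lra)) (force eps tau n (th s))) as Hh.
      rewrite (dispersion_mean_zero n _ (force_sum eps tau n (th s))) in Hh.
      fold (energy eps tau n (th s)) in Hh.
      assert (hessian eps tau n (th s) (force eps tau n (th s)) + c * energy eps tau n (th s) <= 0)
        by (unfold c; lra).
      nra. }
  rewrite Rmult_0_r, exp_0, Rmult_1_r in H.
  rewrite exp_Ropp. pose proof (exp_pos (c * t)).
  apply Rmult_le_reg_r with (exp (c * t)); [easy|].
  rewrite Rmult_assoc, Rinv_l, Rmult_1_r by lra. exact H.
Qed.

(** [A] is a budget for the total displacement: the energy bound makes each force at most
    [mu * INR n * A] at time 0, and at the decay rate [mu * INR n] its time integral is at most [A].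
    The integral is replaced by comparison with [A * exp (- (lam * u))]. *)
Lemma flow_displacement eps tau n b r mu th0 th T A :
  0 < eps -> (0 < n)%nat -> 0 < mu -> 0 <= A ->
  concave_on_box eps tau n b r mu -> angle_flow eps tau n th0 th ->
  (forall s, 0 <= s <= T -> in_box n b r (th s)) ->
  energy eps tau n (th 0) <= (mu * INR n * A) ^ 2 ->
  forall i, (i < n)%nat ->
    (forall t, 0 <= t <= T ->
       Rabs (force eps tau n (th t) i) <= mu * INR n * A * exp (- (mu * INR n * t))) /\
    (forall s t, 0 <= s <= t -> t <= T ->
       Rabs (th t i - th s i) <= A * exp (- (mu * INR n * s))).
Proof.
  intros He Hn Hmu HA Hcv Hfl Hbox HW i Hi.
  assert (Hn' : 0 < INR n) by now apply lt_0_INR.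
  set (lam := mu * INR n) in *. assert (Hlam : 0 < lam) by (unfold lam; nra).
  assert (HF : forall t, 0 <= t <= T ->
       Rabs (force eps tau n (th t) i) <= lam * A * exp (- (lam * t))).
  { intros t Ht. apply Rsqr_incr_0_var.
    2:{ pose proof (exp_pos (- (lam * t))). apply Rmult_le_pos; nra. }
    rewrite <- Rsqr_abs.
    apply Rle_trans with (energy eps tau n (th t)).
    - unfold Rsqr. replace (_ * _) with (force eps tau n (th t) i ^ 2) by ring.
      apply (sumR_term_le n (fun i => force eps tau n (th t) i ^ 2)); [|assumption].
      intros; apply pow2_ge_0.
    - eapply Rle_trans; [eapply energy_decay; eassumption|]. fold lam.
      replace (- (2 * lam * t)) with (- (lam * t) + - (lam * t)) by ring.
      rewrite exp_plus. pose proof (exp_pos (- (lam * t))). unfold Rsqr.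
      replace (lam * A * exp (- (lam * t)) * (lam * A * exp (- (lam * t))))
        with ((lam * A) ^ 2 * (exp (- (lam * t)) * exp (- (lam * t)))) by ring.
      apply Rmult_le_compat_r; [nra|exact HW]. }
  split; [exact HF|].
  destruct Hfl as [_ Hd].
  intros s t Hst HtT.
  assert (Hdi : forall x, s <= x <= t -> is_derive (fun u => th u i) x (force eps tau n (th x) i)).
  { intros x Hx. specialize (Hd x i Hi). rewrite Rmax_left in Hd by lra. exact Hd. }
  assert (Hde : forall x, is_derive (fun u => A * exp (- (lam * u))) x
                  (- (lam * A * exp (- (lam * x))))).
  { intros x. auto_derive; [easy|ring]. }
  pose proof (exp_pos (- (lam * t))) as Hep.
  assert (H1 : th t i + A * exp (- (lam * t)) <= th s i + A * exp (- (lam * s))).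
  { apply (derive_le_decreasing (fun u => th u i + A * exp (- (lam * u)))
      (fun x => force eps tau n (th x) i + - (lam * A * exp (- (lam * x))))); [lra| |].
    - intros x Hx. apply (is_derive_plus (fun u => th u i)); auto.
    - intros x Hx. specialize (HF x ltac:(lra)). apply Rabs_le_between in HF. lra. }
  assert (H2 : - th t i + A * exp (- (lam * t)) <= - th s i + A * exp (- (lam * s))).
  { apply (derive_le_decreasing (fun u => - th u i + A * exp (- (lam * u)))
      (fun x => - force eps tau n (th x) i + - (lam * A * exp (- (lam * x))))); [lra| |].
    - intros x Hx. apply (is_derive_plus (fun u => - th u i)); auto.
      apply (is_derive_opp (fun u => th u i)); auto.
    - intros x Hx. specialize (HF x ltac:(lra)). apply Rabs_le_between in HF. lra. }
  assert (0 <= A * exp (- (lam * t))) by nra.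
  apply Rabs_le; split; lra.
Qed.

(* The velocity bound [n] lets the box estimate be propagated by time steps of fixed length. *)
Lemma flow_stays eps tau n b r mu th0 th :
  0 < eps -> (0 < n)%nat -> 0 < mu -> 0 < r ->
  concave_on_box eps tau n b r mu -> angle_flow eps tau n th0 th ->
  in_box n b (r / 4) th0 -> energy eps tau n (th 0) <= (mu * INR n * (r / 4)) ^ 2 ->
  forall t, 0 <= t -> in_box n b r (th t).
Proof.
  intros He Hn Hmu Hr Hcv Hfl H0 HW.
  pose proof (lt_0_INR n Hn) as Hn'.
  (* At speed at most [INR n], a step of length [d] moves an angle by at most [r / 2]. Together with
     the initial offset [r / 4] and the displacement [r / 4] up to the start of the step, this stays
     within [r]. *)
  set (d := r / (2 * INR n)).
  assert (Hd : 0 < d) by (apply Rdiv_lt_0_compat; lra).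
  assert (Hnd : INR n * d = r / 2) by (unfold d; field; lra).
  assert (Hk : forall k t, 0 <= t <= INR k * d -> in_box n b r (th t)).
  { induction k as [|k IH]; intros t Ht i Hi.
    - simpl in Ht. assert (t = 0) as -> by lra.
      rewrite (proj1 Hfl i Hi). pose proof (H0 i Hi). lra.
    - destruct (Rle_dec t (INR k * d)) as [Hle|Hgt]; [apply (IH t); [lra|assumption]|].
      rewrite S_INR in Ht.
      assert (HT : 0 <= INR k * d) by (apply Rmult_le_pos; [apply pos_INR|lra]).
      destruct (flow_displacement eps tau n b r mu th0 th (INR k * d) (r / 4)) with (i := i)
        as [_ Hdis]; auto; [lra|].
      specialize (Hdis 0 (INR k * d) ltac:(lra) ltac:(lra)).
      rewrite Rmult_0_r, Ropp_0, exp_0, (proj1 Hfl i Hi) in Hdis.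
      specialize (H0 i Hi).
      assert (Hs : Rabs (th t i - th (INR k * d) i) <= INR n * Rabs (t - INR k * d)).
      { apply (derive_bound_lipschitz (fun s => th s i)
                 (fun s => force eps tau n (th (Rmax s 0)) i)).
        - intros x. now apply Hfl.
        - intros x. apply force_bound. }
      rewrite (Rabs_pos_eq (t - INR k * d)) in Hs by lra.
      assert (INR n * (t - INR k * d) <= r / 2) by (rewrite <- Hnd; apply Rmult_le_compat_l; lra).
      apply Rabs_le_between in Hs, Hdis, H0. apply Rabs_le. lra. }
  intros t Ht. destruct (INR_unbounded (t / d)) as [k Hkt]. apply (Hk k). split; [easy|].
  apply Rmult_lt_compat_r with (r := d) in Hkt; [|easy].
  unfold Rdiv in Hkt. rewrite Rmult_assoc, Rinv_l in Hkt by lra. lra.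
Qed.

(** * From limits of trajectories to local maxima *)

Lemma fobj_ang eps tau n th :
  fobj eps tau n (ang th)
  = / 2 * sumR n (fun i => sumR n (fun j => phi eps tau (cos (th i - th j)))).
Proof.
  unfold fobj. f_equal. apply sumR_ext; intros i _. apply sumR_ext; intros j _.
  unfold dot, ang; simpl. now rewrite cos_minus.
Qed.

Lemma fobj_ext eps tau n X Y :
  (forall i, (i < n)%nat -> X i = Y i) -> fobj eps tau n X = fobj eps tau n Y.
Proof.
  intros H. unfold fobj. f_equal. apply sumR_ext; intros i Hi. apply sumR_ext; intros j Hj.
  now rewrite !H.
Qed.

(** The box is convex, so [fobj] is concave along the segment from [th] to [et], and its slope
    vanishes at [th]. Concavity modulo rotations suffices, since only a sign of the second
    derivative is used. *)
Lemma critical_max_in_box eps tau n b r mu th et :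
  0 < eps -> 0 <= mu -> concave_on_box eps tau n b r mu ->
  in_box n b r th -> in_box n b r et ->
  (forall i, (i < n)%nat -> force eps tau n th i = 0) ->
  fobj eps tau n (ang et) <= fobj eps tau n (ang th).
Proof.
  intros He Hmu Hcv Hth Het Hcr.
  set (w := fun i => et i - th i). set (p := fun (s : R) i => th i + s * w i).
  set (g := fun s => / 2 * sumR n (fun i => sumR n (fun j => phi eps tau (cos (p s i - p s j))))).
  set (g1 := fun s => sumR n (fun i => w i * force eps tau n (p s) i)).
  assert (Hp : forall s i, is_derive (fun s => p s i) s (w i)).
  { intros s i. unfold p. auto_derive; [easy|ring]. }
  assert (Hg : forall s, is_derive g s (g1 s)).
  { intros s. eapply is_derive_eq.
    - apply (is_derive_scal (fun s =>
        sumR n (fun i => sumR n (fun j => phi eps tau (cos (p s i - p s j)))))).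
      apply (is_derive_sumR n (fun i s => sumR n (fun j => phi eps tau (cos (p s i - p s j))))
        (fun i => sumR n (fun j => h1 eps tau (p s i - p s j) * (w i - w j)))).
      intros i _.
      apply (is_derive_sumR n (fun j s => phi eps tau (cos (p s i - p s j)))).
      intros j _. eapply is_derive_eq.
      + apply (is_derive_comp (fun x => phi eps tau (cos x)) (fun s => p s i - p s j)).
        * now apply is_derive_phi_cos.
        * apply (is_derive_minus (fun s => p s i) (fun s => p s j)); apply Hp.
      + unfold scal, minus, plus, opp; simpl; unfold mult; simpl. ring.
    - unfold g1.
      rewrite <- (sumR_symmetrize n (fun i j => w i * h1 eps tau (p s i - p s j))).
      + rewrite <- Rmult_assoc, Rinv_l, Rmult_1_l by lra.
        apply sumR_ext; intros i _. unfold force. now rewrite sumR_scal.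
      + intros i j _ _. replace (p s j - p s i) with (- (p s i - p s j)) by ring.
        rewrite h1_odd. ring. }
  assert (Hg1 : forall s, is_derive g1 s (/ 2 * hessian eps tau n (p s) w)).
  { intros s. eapply is_derive_eq.
    - apply (is_derive_sumR n (fun i s => w i * force eps tau n (p s) i)
        (fun i => w i * sumR n (fun j => h2 eps tau (p s i - p s j) * (w i - w j)))).
      intros i Hi. apply (is_derive_scal (fun s => force eps tau n (p s) i)).
      apply is_derive_force; auto.
    - unfold hessian.
      rewrite <- (sumR_symmetrize n
        (fun i j => w i * (h2 eps tau (p s i - p s j) * (w i - w j)))).
      + rewrite <- Rmult_assoc, Rinv_l, Rmult_1_l by lra.
        apply sumR_ext; intros i _. now rewrite sumR_scal.
      + intros i j _ _. replace (p s j - p s i) with (- (p s i - p s j)) by ring.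
        rewrite h2_even. ring. }
  assert (Hbx : forall s, 0 <= s <= 1 -> in_box n b r (p s)).
  { intros s Hs i Hi. specialize (Hth i Hi). specialize (Het i Hi).
    apply Rabs_le_between in Hth, Het. unfold p, w.
    apply Rabs_le; split; nra. }
  assert (Hneg : forall s, 0 <= s <= 1 -> g1 s <= 0).
  { intros s Hs. replace 0 with (g1 0).
    - apply (derive_le_decreasing g1 (fun s => / 2 * hessian eps tau n (p s) w)); [lra|auto|].
      intros x Hx. pose proof (Hcv (p x) (Hbx x ltac:(lra)) w) as Hh.
      pose proof (dispersion_nonneg n w). nra.
    - unfold g1. apply sumR_0. intros i Hi.
      replace (force eps tau n (p 0) i) with (force eps tau n th i); [rewrite Hcr by easy; ring|].
      apply sumR_ext; intros j _. unfold p. f_equal; ring. }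
  assert (Hle : g 1 <= g 0).
  { apply (derive_le_decreasing g g1); [lra|auto|auto]. }
  rewrite !fobj_ang.
  replace (/ 2 * sumR n (fun i => sumR n (fun j => phi eps tau (cos (et i - et j))))) with (g 1).
  - replace (/ 2 * sumR n (fun i => sumR n (fun j => phi eps tau (cos (th i - th j))))) with (g 0);
      [exact Hle|].
    unfold g. f_equal. apply sumR_ext; intros i _. apply sumR_ext; intros j _.
    unfold p. do 2 f_equal; ring.
  - unfold g. f_equal. apply sumR_ext; intros i _. apply sumR_ext; intros j _.
    unfold p, w. do 2 f_equal; ring.
Qed.

(** In the frame turned by [a], the point [y] has coordinates [(c, s)] with [c] nonnegative and [s]
    at most [sin rho] in absolute value; hence [asin s] is its angle relative to [a]. *)
Lemma circle_lift_near (y : pt) (a rho : R) :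
  0 < rho <= 1 -> dot y y = 1 ->
  Rabs (fst y - cos a) < sin rho / 2 -> Rabs (snd y - sin a) < sin rho / 2 ->
  exists e, Rabs (e - a) <= rho /\ y = (cos e, sin e).
Proof.
  intros Hr Hy H1 H2. destruct y as [u v]; simpl in *. unfold dot in Hy; simpl in Hy.
  pose proof PI2_1 as Hpi. pose proof (SIN_bound rho) as Hsr.
  set (c := u * cos a + v * sin a). set (s := v * cos a - u * sin a).
  pose proof (sin2_cos2 a) as Hsc. unfold Rsqr in Hsc.
  pose proof (SIN_bound a) as Hsa. pose proof (COS_bound a) as Hca.
  assert (Hcs : c * c + s * s = 1).
  { transitivity ((u * u + v * v) * (sin a * sin a + cos a * cos a)); [unfold c, s; ring|].
    rewrite Hy, Hsc; ring. }
  apply Rabs_def2 in H1, H2.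
  assert (Hs : - sin rho <= s <= sin rho).
  { replace s with ((v - sin a) * cos a - (u - cos a) * sin a) by (unfold s; ring). split; nra. }
  assert (Hc : 0 <= c).
  { replace c with ((sin a * sin a + cos a * cos a) + ((v - sin a) * sin a + (u - cos a) * cos a))
      by (unfold c; ring). rewrite Hsc. nra. }
  assert (Hs1 : -1 <= s <= 1) by lra.
  pose proof (asin_bound s) as Hab.
  assert (Hsin : sin (asin s) = s) by now apply sin_asin.
  assert (Hcos : cos (asin s) = c).
  { rewrite cos_asin by easy. apply Rsqr_inj; [apply sqrt_pos|easy|].
    rewrite Rsqr_sqrt by (unfold Rsqr; nra). unfold Rsqr; lra. }
  exists (a + asin s). split.
  - replace (a + asin s - a) with (asin s) by ring. apply Rabs_le; split.
    + apply Rnot_lt_le. intros Hlt.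
      assert (sin (asin s) < sin (- rho)) by (apply sin_increasing_1; lra).
      rewrite sin_neg in *. lra.
    + apply Rnot_lt_le. intros Hlt.
      assert (sin rho < sin (asin s)) by (apply sin_increasing_1; lra). lra.
  - rewrite cos_plus, sin_plus, Hsin, Hcos. unfold c, s. f_equal.
    + transitivity (u * (sin a * sin a + cos a * cos a)); [rewrite Hsc|]; ring.
    + transitivity (v * (sin a * sin a + cos a * cos a)); [rewrite Hsc|]; ring.
Qed.

Lemma basin_good_init eps tau n b r mu th0 :
  0 < eps -> (0 < n)%nat -> 0 < mu -> 0 < r <= 1 ->
  concave_on_box eps tau n b r mu ->
  (exists i j, (i < n)%nat /\ (j < n)%nat /\
     forall th, in_box n b r th -> cos (th i - th j) < 1) ->
  in_box n b (r / 4) th0 -> energy eps tau n th0 <= (mu * INR n * (r / 4)) ^ 2 ->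
  good_init eps tau n (ang th0).
Proof.
  intros He Hn Hmu Hr Hcv (i0 & j0 & Hi0 & Hj0 & Hns) H0 HW0.
  split; [apply ang_on_torus|]. split.
  { destruct (angle_flow_exists eps tau n th0 He) as [th Hth].
    exists (fun t => ang (th t)). now apply angle_flow_is_flow. }
  intros X HX. destruct (flow_lift eps tau n th0 X He HX) as (th & Hfl & HXth).
  assert (HW : energy eps tau n (th 0) <= (mu * INR n * (r / 4)) ^ 2).
  { replace (energy eps tau n (th 0)) with (energy eps tau n th0); [easy|].
    apply sumR_ext; intros i Hi. f_equal. apply sumR_ext; intros j Hj.
    now rewrite !(proj1 Hfl). }
  pose proof (lt_0_INR n Hn) as Hn'.
  set (lam := mu * INR n) in *. assert (Hlam : 0 < lam) by (unfold lam; nra).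
  assert (Hbox : forall t, 0 <= t -> in_box n b r (th t))
    by (apply (flow_stays eps tau n b r mu th0 th He Hn Hmu (proj1 Hr) Hcv Hfl H0 HW)).
  assert (Hdis : forall i, (i < n)%nat ->
    (forall t, 0 <= t -> Rabs (force eps tau n (th t) i) <= lam * (r / 4) * exp (- (lam * t))) /\
    (forall s t, 0 <= s <= t -> Rabs (th t i - th s i) <= r / 4 * exp (- (lam * s)))).
  { intros i Hi. split.
    - intros t Ht.
      destruct (flow_displacement eps tau n b r mu th0 th t (r / 4)) with (i := i) as [HF _]; auto.
      + lra.
      + intros s Hs; apply Hbox; lra.
      + apply HF; lra.
    - intros s t Hst.
      destruct (flow_displacement eps tau n b r mu th0 th t (r / 4)) with (i := i) as [_ HD]; auto.
      + lra.
      + intros x Hx; apply Hbox; lra.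
      + apply HD; lra. }
  assert (Hlim : forall i, exists l, (i < n)%nat ->
            forall t, 0 <= t -> Rabs (th t i - l) <= r / 4 * exp (- (lam * t))).
  { intros i. destruct (Nat.lt_ge_cases i n) as [Hi|Hi]; [|exists 0; lia].
    destruct (exp_cauchy_limit (fun t => th t i) (r / 4) lam) as [l Hl]; [lra|easy| |].
    - now apply Hdis.
    - now exists l. }
  apply choice in Hlim. destruct Hlim as [ths Hlim].
  (* Initial offset [r / 4] plus total displacement at most [r / 4]. The other half of the radius is
     kept for the neighbours of the limit in the local maximum test. *)
  assert (Hbs : in_box n b (r / 2) ths).
  { intros i Hi. specialize (Hlim i Hi 0 (Rle_refl 0)). specialize (H0 i Hi).
    rewrite Rmult_0_r, Ropp_0, exp_0, (proj1 Hfl i Hi) in Hlim.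
    apply Rabs_le_between in Hlim, H0. apply Rabs_le. lra. }
  assert (Hbs' : in_box n b r ths).
  { intros i Hi. specialize (Hbs i Hi). lra. }
  assert (Hcr : forall i, (i < n)%nat -> force eps tau n ths i = 0).
  { intros i Hi. apply Rabs_eq_0, Rle_antisym; [|apply Rabs_pos].
    (* The first term bounds the force at time [T], the second its change between time [T] and the
       limit; both carry the factor [exp (- (lam * T))]. *)
    set (C := lam * (r / 4) + INR n * (2 * (/ eps + 1) * (r / 4))).
    assert (0 < / eps) by now apply Rinv_0_lt_compat.
    assert (HC : 0 <= C).
    { unfold C. apply Rplus_le_le_0_compat; repeat apply Rmult_le_pos; lra. }
    apply Rnot_lt_le. intros Hlt.
    destruct (exp_decay_small C lam (Rabs (force eps tau n ths i)) HC Hlam Hlt) as (T & HT & HTs).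
    specialize (HTs T (Rle_refl T)).
    pose proof (proj1 (Hdis i Hi) T HT) as H1.
    assert (H2 : Rabs (force eps tau n ths i - force eps tau n (th T) i)
              <= INR n * (2 * (/ eps + 1) * (r / 4 * exp (- (lam * T))))).
    { apply force_lipschitz; auto. intros j Hj. rewrite Rabs_minus_sym. now apply Hlim. }
    pose proof (Rabs_triang (force eps tau n ths i - force eps tau n (th T) i)
                  (force eps tau n (th T) i)) as H3.
    replace (force eps tau n ths i - force eps tau n (th T) i + force eps tau n (th T) i)
      with (force eps tau n ths i) in H3 by ring.
    unfold C in HTs. lra. }
  exists (ang ths). split; [|split].
  - intros i Hi.
    assert (Hl : is_lim (fun t => th t i) p_infty (ths i)).
    { apply exp_cauchy_is_lim with (r / 4) lam; [lra|easy|]. now apply Hlim. }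
    unfold ang; simpl. split.
    + apply is_lim_ext_loc with (fun t => cos (th t i)).
      * exists 0. intros t Ht. rewrite HXth by (auto; lra). reflexivity.
      * apply (is_lim_comp_continuous (fun t => th t i) cos); [easy|apply continuous_cos].
    + apply is_lim_ext_loc with (fun t => sin (th t i)).
      * exists 0. intros t Ht. rewrite HXth by (auto; lra). reflexivity.
      * apply (is_lim_comp_continuous (fun t => th t i) sin); [easy|apply continuous_sin].
  - split; [apply ang_on_torus|].
    assert (Hpi : 0 < sin (r / 2)).
    { apply sin_gt_0; pose proof PI2_1; lra. }
    (* The tolerance of [circle_lift_near] for the radius [r / 2]: competitors lift to angles within
       [r / 2] of the limit, hence within the box of radius [r]. *)
    exists (sin (r / 2) / 2). split; [lra|]. intros Y HY Hnear.
    assert (Het : forall i, exists e, (i < n)%nat -> Rabs (e - ths i) <= r / 2 /\ Y i = (cos e, sin e)).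
    { intros i. destruct (Nat.lt_ge_cases i n) as [Hi|Hi]; [|exists 0; lia].
      destruct (Hnear i Hi) as [Hx Hy].
      destruct (circle_lift_near (Y i) (ths i) (r / 2)) as [e Hee]; auto; [lra|].
      now exists e. }
    apply choice in Het. destruct Het as [et Het].
    rewrite (fobj_ext eps tau n Y (ang et)) by (intros i Hi; now apply Het).
    apply (critical_max_in_box eps tau n b r mu); auto; [lra|].
    intros i Hi. specialize (Hbs i Hi). destruct (Het i Hi) as [Hd _].
    apply Rabs_le_between in Hbs, Hd. apply Rabs_le. lra.
  - intros Hsy. specialize (Hsy i0 j0 Hi0 Hj0). unfold ang in Hsy. injection Hsy as Hc Hs.
    specialize (Hns ths Hbs'). rewrite cos_minus, Hc, Hs in Hns.
    pose proof (sin2_cos2 (ths j0)) as H1. unfold Rsqr in H1. lra.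
Qed.

(** * Boxes are not Lebesgue-null *)

Lemma prodR_ext n f g : (forall i, (i < n)%nat -> f i = g i) -> prodR n f = prodR n g.
Proof.
  induction n as [|n IH]; intros H; simpl; [reflexivity|].
  rewrite IH, H; auto with arith.
Qed.

Lemma prodR_pos n f : (forall i, (i < n)%nat -> 0 < f i) -> 0 < prodR n f.
Proof.
  induction n as [|n IH]; intros H; simpl; [lra|].
  apply Rmult_lt_0_compat; auto with arith.
Qed.

Lemma prodR_nonneg n f : (forall i, (i < n)%nat -> 0 <= f i) -> 0 <= prodR n f.
Proof.
  induction n as [|n IH]; intros H; simpl; [lra|].
  apply Rmult_le_pos; auto with arith.
Qed.

Lemma prodR_le n f g :
  (forall i, (i < n)%nat -> 0 <= f i <= g i) -> prodR n f <= prodR n g.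
Proof.
  induction n as [|n IH]; intros H; simpl; [lra|].
  apply Rmult_le_compat.
  - apply prodR_nonneg. intros i Hi; apply H; lia.
  - apply H; lia.
  - apply IH. intros i Hi; apply H; lia.
  - apply H; lia.
Qed.

Lemma prodR_split_coord n i e f g :
  (i < n)%nat -> e i = f i + g i ->
  (forall j, (j < n)%nat -> j <> i -> e j = f j /\ e j = g j) ->
  prodR n e = prodR n f + prodR n g.
Proof.
  induction n as [|n IH]; intros Hi Hs Ho; [lia|]. simpl.
  destruct (Nat.eq_dec i n) as [->|Hne].
  - rewrite Hs, (prodR_ext n f e), (prodR_ext n g e); [ring| |];
      intros j Hj; symmetry; apply Ho; lia.
  - rewrite IH; [|lia|assumption|intros j Hj Hji; apply Ho; lia].
    destruct (Ho n) as [H1 H2]; [lia|lia|]. rewrite <- H1, <- H2. ring.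
Qed.

(** By continuity of the product in [d]. It lets the closed boxes of a cover be thickened to open
    ones at an arbitrarily small cost in volume. *)
Lemma prodR_enlarge n f e :
  0 < e -> exists d, 0 < d /\ prodR n (fun i => f i + 2 * d) <= prodR n f + e.
Proof.
  intros He.
  assert (Hc : forall m, continuous (fun d => prodR m (fun i => f i + 2 * d)) 0).
  { induction m as [|m IH]; simpl; [apply continuous_const|].
    apply (continuous_mult (fun d => prodR m (fun i => f i + 2 * d)) (fun d => f m + 2 * d));
      [exact IH|].
    apply (ex_derive_continuous (fun d => f m + 2 * d)). auto_derive; easy. }
  specialize (Hc n). apply continuity_pt_filterlim in Hc.
  destruct (Hc e He) as (a & Ha & H). exists (a / 2). split; [lra|].
  assert (Hd : Rabs (prodR n (fun i => f i + 2 * (a / 2)) - prodR n (fun i => f i + 2 * 0)) < e).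
  { apply H. split; [split; [easy|lra]|]. simpl. unfold Rdist. rewrite Rminus_0_r, Rabs_pos_eq; lra. }
  rewrite (prodR_ext n (fun i => f i + 2 * 0) f) in Hd by (intros; ring).
  apply Rabs_def2 in Hd. lra.
Qed.

Definition overlap (a b l h : R) : R := Rmax 0 (Rmin b h - Rmax a l).

Definition vol (n : nat) (a b : nat -> R) : R := prodR n (fun i => b i - a i).

Definition overlap_vol (n : nat) (a b l h : nat -> R) : R :=
  prodR n (fun i => overlap (a i) (b i) (l i) (h i)).

(** The covering boxes meet at most half of the volume of [q], counted with multiplicity. Bounding
    all partial sums avoids convergence questions; the fraction [/ 2] leaves room for thickening the
    cover, yet is contradicted by any single covering box that contains [q]. *)
Definition undercovered (n : nat) (lo hi : nat -> nat -> R) (q : (nat -> R) * (nat -> R)) : Prop :=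
  (forall i, (i < n)%nat -> fst q i < snd q i) /\
  forall K, sumR K (fun k => overlap_vol n (fst q) (snd q) (lo k) (hi k))
            <= / 2 * vol n (fst q) (snd q).

Lemma overlap_nonneg a b l h : 0 <= overlap a b l h.
Proof. apply Rmax_l. Qed.

Lemma overlap_split a m b l h :
  a <= m <= b -> overlap a b l h = overlap a m l h + overlap m b l h.
Proof.
  intros H. unfold overlap, Rmax, Rmin.
  destruct (Rle_dec b h), (Rle_dec a l), (Rle_dec m h), (Rle_dec m l);
    repeat match goal with |- context [Rle_dec ?x ?y] => destruct (Rle_dec x y) end; lra.
Qed.

Lemma overlap_vol_nonneg n a b l h : 0 <= overlap_vol n a b l h.
Proof. apply prodR_nonneg; intros; apply overlap_nonneg. Qed.

Lemma sumR_le_mono K K' f : (forall k, 0 <= f k) -> (K <= K')%nat -> sumR K f <= sumR K' f.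
Proof.
  intros Hf HK. replace K' with (K + (K' - K))%nat by lia. rewrite sumR_split.
  pose proof (sumR_nonneg (K' - K) (fun j => f (K + j)%nat)).
  assert (0 <= sumR (K' - K) (fun j => f (K + j)%nat)) by auto. lra.
Qed.

(** Volume and overlap are both additive over the two halves. If each half were covered beyond its
    half volume, the sum up to the larger of the two witnesses would exceed half the volume of
    [q]. *)
Lemma undercovered_halve n lo hi q i :
  undercovered n lo hi q -> (i < n)%nat ->
  exists q', undercovered n lo hi q' /\
    fst q i <= fst q' i /\ snd q' i <= snd q i /\
    snd q' i - fst q' i = (snd q i - fst q i) / 2 /\
    forall j, j <> i -> fst q' j = fst q j /\ snd q' j = snd q j.
Proof.
  intros [Hq Hs] Hi. destruct q as [a b]; simpl in *.
  set (m := (a i + b i) / 2). pose proof (Hq i Hi) as Hab.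
  assert (Hm : a i < m < b i) by (unfold m; lra).
  set (b' := fun j => if Nat.eqb j i then m else b j).
  set (a' := fun j => if Nat.eqb j i then m else a j).
  assert (Hbi : b' i = m) by (unfold b'; now rewrite Nat.eqb_refl).
  assert (Hai : a' i = m) by (unfold a'; now rewrite Nat.eqb_refl).
  assert (Hbj : forall j, j <> i -> b' j = b j).
  { intros j Hj. unfold b'. now rewrite (proj2 (Nat.eqb_neq j i) Hj). }
  assert (Haj : forall j, j <> i -> a' j = a j).
  { intros j Hj. unfold a'. now rewrite (proj2 (Nat.eqb_neq j i) Hj). }
  assert (Hvol : vol n a b = vol n a b' + vol n a' b).
  { apply prodR_split_coord with i; [easy|rewrite Hbi, Hai; ring|].
    intros j _ Hj. rewrite Hbj, Haj by easy. now split. }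
  assert (Hv2 : vol n a b' = vol n a' b).
  { apply prodR_ext; intros j _. destruct (Nat.eq_dec j i) as [->|Hj].
    - rewrite Hbi, Hai. unfold m; field.
    - now rewrite Hbj, Haj. }
  assert (Hov : forall k, overlap_vol n a b (lo k) (hi k)
      = overlap_vol n a b' (lo k) (hi k) + overlap_vol n a' b (lo k) (hi k)).
  { intros k. apply prodR_split_coord with i; [easy|rewrite Hbi, Hai; apply overlap_split; lra|].
    intros j _ Hj. rewrite Hbj, Haj by easy. now split. }
  destruct (classic (undercovered n lo hi (a, b'))) as [Hl|Hl].
  { exists (a, b'). simpl. repeat split; try apply Hl; rewrite ?Hbi; auto with real; try lra.
    unfold m; field. }
  destruct (classic (undercovered n lo hi (a', b))) as [Hr|Hr].
  { exists (a', b). simpl. repeat split; try apply Hr; rewrite ?Hai; auto with real; try lra.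
    unfold m; field. }
  exfalso.
  assert (HK1 : exists K, / 2 * vol n a b' < sumR K (fun k => overlap_vol n a b' (lo k) (hi k))).
  { apply NNPP. intros Hn. apply Hl. split; simpl.
    - intros j Hj. destruct (Nat.eq_dec j i) as [->|Hne]; [lra|rewrite Hbj by easy; auto].
    - intros K. apply Rnot_lt_le. intros Hlt. apply Hn. now exists K. }
  assert (HK2 : exists K, / 2 * vol n a' b < sumR K (fun k => overlap_vol n a' b (lo k) (hi k))).
  { apply NNPP. intros Hn. apply Hr. split; simpl.
    - intros j Hj. destruct (Nat.eq_dec j i) as [->|Hne]; [lra|rewrite Haj by easy; auto].
    - intros K. apply Rnot_lt_le. intros Hlt. apply Hn. now exists K. }
  destruct HK1 as [K1 HK1], HK2 as [K2 HK2].
  specialize (Hs (Nat.max K1 K2)).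
  rewrite (sumR_ext _ _ (fun k => overlap_vol n a b' (lo k) (hi k)
                           + overlap_vol n a' b (lo k) (hi k))), sumR_plus in Hs by auto.
  pose proof (sumR_le_mono K1 (Nat.max K1 K2) (fun k => overlap_vol n a b' (lo k) (hi k))
    ltac:(intros; apply overlap_vol_nonneg) ltac:(lia)).
  pose proof (sumR_le_mono K2 (Nat.max K1 K2) (fun k => overlap_vol n a' b (lo k) (hi k))
    ltac:(intros; apply overlap_vol_nonneg) ltac:(lia)).
  lra.
Qed.

Lemma undercovered_halve_all n lo hi q :
  undercovered n lo hi q ->
  exists q', undercovered n lo hi q' /\
    forall i, (i < n)%nat -> fst q i <= fst q' i /\ snd q' i <= snd q i /\
      snd q' i - fst q' i = (snd q i - fst q i) / 2.
Proof.
  intros Hq.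
  (* Coordinates are halved one at a time; those from [m] on are recorded as untouched so that the
     next one still has its original length. *)
  assert (H : forall m, (m <= n)%nat -> exists q', undercovered n lo hi q' /\
    (forall i, (i < m)%nat -> fst q i <= fst q' i /\ snd q' i <= snd q i /\
      snd q' i - fst q' i = (snd q i - fst q i) / 2) /\
    (forall i, (m <= i)%nat -> fst q' i = fst q i /\ snd q' i = snd q i)).
  { induction m as [|m IH]; intros Hm.
    - exists q. repeat split; try apply Hq; lia.
    - destruct IH as (q1 & Hu & H1 & H2); [lia|].
      destruct (undercovered_halve n lo hi q1 m Hu) as (q2 & Hu2 & Ha & Hb & Hl & Ho); [lia|].
      exists q2. split; [easy|]. destruct (H2 m (Nat.le_refl m)) as [E1 E2].
      rewrite E1, E2 in *. split.
      + intros i Hi. destruct (Nat.eq_dec i m) as [->|Hne]; [auto|].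
        destruct (Ho i Hne) as [-> ->]. apply H1; lia.
      + intros i Hi. destruct (Ho i) as [-> ->]; [lia|]. apply H2; lia. }
  destruct (H n (Nat.le_refl n)) as (q' & Hu & H1 & _). now exists q'.
Qed.

Lemma finite_eventually n (P : nat -> nat -> Prop) :
  (forall i, (i < n)%nat -> exists M, forall m, (M <= m)%nat -> P i m) ->
  exists M, forall m i, (M <= m)%nat -> (i < n)%nat -> P i m.
Proof.
  induction n as [|n IH]; intros H; [exists 0%nat; lia|].
  destruct IH as [M1 H1]; [auto with arith|].
  destruct (H n (Nat.lt_succ_diag_r n)) as [M2 H2].
  exists (Nat.max M1 M2). intros m i Hm Hi.
  destruct (Nat.eq_dec i n) as [->|Hne]; [apply H2; lia|apply H1; lia].
Qed.

Lemma nested_halving_point (a b : nat -> R) :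
  (forall k, a k <= a (S k) /\ b (S k) <= b k /\ b (S k) - a (S k) = (b k - a k) / 2) ->
  a 0%nat <= b 0%nat ->
  exists x, forall l h, l < x < h -> exists M, forall m, (M <= m)%nat -> l < a m /\ b m < h.
Proof.
  intros H H0.
  assert (Hl : forall k, b k - a k = (b 0%nat - a 0%nat) * (/ 2) ^ k).
  { induction k as [|k IH]; [simpl; ring|].
    destruct (H k) as (_ & _ & ->). rewrite IH. simpl. field. }
  assert (Hpos : forall k, a k <= b k).
  { intros k. specialize (Hl k). assert (0 <= (/ 2) ^ k) by (apply pow_le; lra). nra. }
  destruct (geom_cauchy_lim a (b 0%nat - a 0%nat)) as [Hlim Hr].
  { intros k. destruct (H k) as (H1 & H2 & H3). pose proof (Hpos (S k)). pose proof (Hl k).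
    rewrite Rabs_pos_eq; lra. }
  set (x := real (Lim_seq a)) in *. exists x. intros l h Hx.
  (* The left end is within [2 * (b 0 - a 0) * (/ 2) ^ k] of the limit, and the right end at most
     one more interval length away: three lengths in all. *)
  assert (Hg : is_lim_seq (fun k => 3 * (b 0%nat - a 0%nat) * (/ 2) ^ k) (3 * (b 0%nat - a 0%nat) * 0)).
  { apply (is_lim_seq_scal_l _ _ 0). apply is_lim_seq_geom. rewrite Rabs_pos_eq; lra. }
  rewrite Rmult_0_r in Hg. apply is_lim_seq_spec in Hg.
  assert (He : 0 < Rmin (x - l) (h - x)) by (apply Rmin_glb_lt; lra).
  destruct (Hg (mkposreal _ He)) as [M HM]. exists M. intros m Hm. specialize (HM m Hm).
  simpl in HM. rewrite Rminus_0_r in HM. apply Rabs_def2 in HM.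
  specialize (Hr m). apply Rabs_le_between in Hr. specialize (Hl m).
  pose proof (Rmin_l (x - l) (h - x)). pose proof (Rmin_r (x - l) (h - x)).
  pose proof (Hpos m). lra.
Qed.

(* Bisection: one half of an undercovered box is again undercovered, and near the limit
   point a single open box of the cover contains the whole bisected box. *)
Lemma undercovered_not_covered n lo hi q :
  undercovered n lo hi q ->
  ~ (forall th, (forall i, (i < n)%nat -> fst q i <= th i <= snd q i) ->
       exists k, forall i, (i < n)%nat -> lo k i < th i < hi k i).
Proof.
  intros Hq Hcov.
  assert (Hstep : forall p, exists p', undercovered n lo hi p -> undercovered n lo hi p' /\
    forall i, (i < n)%nat -> fst p i <= fst p' i /\ snd p' i <= snd p i /\
      snd p' i - fst p' i = (snd p i - fst p i) / 2).
  { intros p. destruct (classic (undercovered n lo hi p)) as [Hp|Hp].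
    - destruct (undercovered_halve_all n lo hi p Hp) as [p' Hp']. now exists p'.
    - now exists p. }
  apply choice in Hstep. destruct Hstep as [f Hf].
  set (s := fun k => Nat.iter k f q).
  assert (Hs : forall k, undercovered n lo hi (s k)).
  { induction k as [|k IH]; [exact Hq|]. apply (Hf (s k) IH). }
  assert (Hn : forall i, exists x, (i < n)%nat ->
    forall l h, l < x < h ->
      exists M, forall m, (M <= m)%nat -> l < fst (s m) i /\ snd (s m) i < h).
  { intros i. destruct (Nat.lt_ge_cases i n) as [Hi|Hi]; [|exists 0; lia].
    destruct (nested_halving_point (fun k => fst (s k) i) (fun k => snd (s k) i)) as [x Hx].
    - intros k. apply (proj2 (Hf (s k) (Hs k)) i Hi).
    - left. now apply Hq.
    - now exists x. }
  apply choice in Hn. destruct Hn as [x Hx].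
  assert (Hmono : forall m i, (i < n)%nat -> fst q i <= fst (s m) i /\ snd (s m) i <= snd q i).
  { induction m as [|m IH]; intros i Hi; [simpl; lra|].
    destruct (Hf (s m) (Hs m)) as [_ H]. specialize (H i Hi). specialize (IH i Hi).
    change (s (S m)) with (f (s m)). lra. }
  destruct (Hcov x) as [k Hk].
  { intros i Hi. split; apply Rnot_lt_le; intros Hlt.
    - destruct (Hx i Hi (x i - 1) (fst q i) ltac:(lra)) as [M HM].
      destruct (HM M (Nat.le_refl M)). pose proof (proj1 (Hs M) i Hi).
      pose proof (Hmono M i Hi). lra.
    - destruct (Hx i Hi (snd q i) (x i + 1) ltac:(lra)) as [M HM].
      destruct (HM M (Nat.le_refl M)). pose proof (proj1 (Hs M) i Hi).
      pose proof (Hmono M i Hi). lra. }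
  destruct (finite_eventually n (fun i m => lo k i < fst (s m) i /\ snd (s m) i < hi k i))
    as [M HM].
  { intros i Hi. apply (Hx i Hi). now apply Hk. }
  destruct (Hs M) as [Hpos Hsum]. specialize (Hsum (S k)). simpl in Hsum.
  assert (Heq : overlap_vol n (fst (s M)) (snd (s M)) (lo k) (hi k) = vol n (fst (s M)) (snd (s M))).
  { apply prodR_ext. intros i Hi. destruct (HM M i (Nat.le_refl M) Hi).
    specialize (Hpos i Hi). unfold overlap.
    rewrite Rmin_left, (Rmax_left (fst (s M) i)), Rmax_right; lra. }
  rewrite Heq in Hsum.
  assert (0 < vol n (fst (s M)) (snd (s M))).
  { apply prodR_pos. intros i Hi. specialize (Hpos i Hi). lra. }
  assert (0 <= sumR k (fun k => overlap_vol n (fst (s M)) (snd (s M)) (lo k) (hi k))).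
  { apply sumR_nonneg. intros; apply overlap_vol_nonneg. }
  lra.
Qed.

(** If the box were null, a cover of total volume [V / 4], thickened by at most [V / 8 * (/ 2) ^ k]
    at its [k]-th member, would have total volume at most [V / 2] and leave the box undercovered,
    although its open members cover it. *)
Lemma box_not_null n b rho (A : (nat -> R) -> Prop) :
  0 < rho -> (forall th, in_box n b rho th -> A th) -> ~ leb_null n A.
Proof.
  intros Hrho HA Hnull.
  set (q := (fun i => b i - rho, fun i => b i + rho)).
  set (V := vol n (fst q) (snd q)).
  assert (HV : 0 < V) by (apply prodR_pos; intros i _; simpl; lra).
  destruct (Hnull (V / 4) ltac:(lra)) as (lo & hi & Hle & Hcov & Hsum).
  assert (Hd : forall k, exists d, 0 < d /\
    prodR n (fun i => hi k i - lo k i + 2 * d)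
    <= prodR n (fun i => hi k i - lo k i) + V / 8 * (/ 2) ^ k).
  { intros k. apply prodR_enlarge. apply Rmult_lt_0_compat; [lra|]. apply pow_lt; lra. }
  apply choice in Hd. destruct Hd as [d Hd].
  apply (undercovered_not_covered n (fun k i => lo k i - d k) (fun k i => hi k i + d k) q).
  - split; [intros i Hi; simpl; lra|]. intros K. fold V.
    apply Rle_trans with
      (sumR K (fun k => prodR n (fun i => hi k i - lo k i) + V / 8 * (/ 2) ^ k)).
    + apply sumR_le. intros k _. destruct (Hd k) as [Hp Hv].
      eapply Rle_trans; [|exact Hv]. apply prodR_le. intros i Hi.
      split; [apply overlap_nonneg|]. specialize (Hle k i Hi). unfold overlap.
      apply Rmax_lub; [lra|]. pose proof (Rmin_r (snd q i) (hi k i + d k)).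
      pose proof (Rmax_r (fst q i) (lo k i - d k)). lra.
    + rewrite sumR_plus, (sumR_scal K (V / 8) (fun k => (/ 2) ^ k)). specialize (Hsum K).
      assert (Hg : sumR K (fun k => (/ 2) ^ k) = 2 * (1 - (/ 2) ^ K)).
      { clear. induction K as [|K IH]; simpl; [ring|]. rewrite IH. field. }
      rewrite Hg. assert (0 < (/ 2) ^ K) by (apply pow_lt; lra). nra.
  - intros th Hth. destruct (Hcov th) as [k Hk].
    + apply HA. intros i Hi. specialize (Hth i Hi). simpl in Hth. apply Rabs_le. lra.
    + exists k. intros i Hi. specialize (Hk i Hi). destruct (Hd k). lra.
Qed.

(** * Concavity near almost balanced configurations *)

(** Quantifies how softplus approaches the positive part of [t - tau]: outside a window of
    half-width [eta] its slope is within [nu] of the step function and its curvature is at most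
    [nu]. *)
Definition sharp (eps tau eta nu : R) : Prop :=
  forall t,
    (tau + eta <= t -> 1 - nu <= dphi eps tau t /\ ddphi eps tau t <= nu) /\
    (t <= tau - eta -> dphi eps tau t <= nu /\ ddphi eps tau t <= nu).

Lemma softplus_sharp eta nu :
  0 < eta -> 0 < nu -> exists eps, 0 < eps /\ forall tau, sharp eps tau eta nu.
Proof.
  (* The factor [/ eps] in [ddphi] must be beaten, so tails of size [nu * eps] are needed. From
     [exp y >= y ^ 2 / 4] at [y >= eta / eps] they are at most [4 * eps ^ 2 / eta ^ 2], whence the
     second bound on [eps]; [eps <= 1] gives [nu * eps <= nu]. The choice does not involve [tau]. *)
  intros Heta Hnu. set (eps := Rmin 1 (nu * eta ^ 2 / 4)).
  assert (0 < nu * eta ^ 2) by (apply Rmult_lt_0_compat; [|apply pow_lt]; easy).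
  assert (Heps : 0 < eps) by (apply Rmin_glb_lt; lra).
  assert (He1 : eps <= 1) by apply Rmin_l.
  assert (He2 : eps <= nu * eta ^ 2 / 4) by apply Rmin_r.
  exists eps. split; [exact Heps|]. intros tau t.
  assert (Hie : 0 < / eps) by now apply Rinv_0_lt_compat.
  assert (HE : forall y, eta / eps <= y -> exp (- y) <= nu * eps).
  { intros y Hy.
    assert (H1 : eta <= eps * y).
    { apply Rmult_le_compat_l with (r := eps) in Hy; [|lra].
      replace (eps * (eta / eps)) with eta in Hy by (field; lra). exact Hy. }
    assert (Hy0 : 0 < y) by (apply Rmult_lt_reg_l with eps; lra).
    assert (H2 : y ^ 2 / 4 <= exp y).
    { replace y with (y / 2 + y / 2) at 2 by field. rewrite exp_plus.
      pose proof (exp_ineq1_le (y / 2)). nra. }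
    assert (H3 : 1 <= nu * eps * (y ^ 2 / 4)).
    { assert (H4 : eta ^ 2 <= (eps * y) ^ 2) by (apply pow_incr; lra).
      assert (eps * 4 <= eps * (nu * eps * y ^ 2)).
      { apply Rle_trans with (nu * eta ^ 2); [lra|].
        apply Rle_trans with (nu * (eps * y) ^ 2); [nra|]. right; ring. }
      assert (4 <= nu * eps * y ^ 2) by (apply Rmult_le_reg_l with eps; lra). lra. }
    rewrite exp_Ropp. pose proof (exp_pos y).
    apply Rmult_le_reg_r with (exp y); [easy|]. rewrite Rinv_l by lra.
    assert (0 < nu * eps) by nra. nra. }
  assert (Hdd : forall a, a <= nu * eps -> a * / eps <= nu).
  { intros a Ha. apply Rmult_le_reg_r with eps; [easy|].
    rewrite Rmult_assoc, Rinv_l by lra. lra. }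
  pose proof (dphi_range eps tau t) as Hr.
  assert (Hne : nu * eps <= nu) by nra.
  split; intros Ht.
  - set (x := (t - tau) / eps).
    assert (Hx : exp (- x) <= nu * eps).
    { apply HE. apply Rmult_le_compat_r; lra. }
    assert (Hd : 1 - dphi eps tau t <= nu * eps).
    { unfold dphi. fold x. pose proof (exp_pos (- x)).
      apply Rle_trans with (exp (- x)); [|easy].
      replace (1 - / (1 + exp (- x))) with (exp (- x) * / (1 + exp (- x))) by (field; lra).
      assert (/ (1 + exp (- x)) <= 1) by (rewrite <- Rinv_1; apply Rinv_le_contravar; lra).
      nra. }
    split; [lra|]. apply Hdd. nra.
  - set (x := (t - tau) / eps).
    assert (Hx : exp (- - x) <= nu * eps).
    { apply HE. unfold x. replace (- ((t - tau) / eps)) with ((tau - t) * / eps) by (field; lra).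
      apply Rmult_le_compat_r; lra. }
    assert (Hd : dphi eps tau t <= nu * eps).
    { apply Rle_trans with (exp (- - x)); [|easy].
      unfold dphi. fold x. rewrite (exp_Ropp (- x)). pose proof (exp_pos (- x)).
      apply Rinv_le_contravar; lra. }
    split; [lra|]. apply Hdd. nra.
Qed.

(** Up to a factor 2, the Laplacian form of the graph joining points with cosine at least [p];
    [dispersion] is the same form for the complete graph. Bounding the latter by the former is a
    Poincare inequality. *)
Definition close_dispersion (n : nat) (b : nat -> R) (p : R) (v : nat -> R) : R :=
  sumR n (fun i => sumR n (fun j =>
    if Rle_dec p (cos (b i - b j)) then (v i - v j) ^ 2 else 0)).

Lemma cos_lipschitz x y : Rabs (cos x - cos y) <= Rabs (x - y).
Proof.
  rewrite <- (Rmult_1_l (Rabs (x - y))).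
  apply (derive_bound_lipschitz cos (fun x => - sin x)).
  - intros z. apply is_derive_Reals, derivable_pt_lim_cos.
  - intros z. pose proof (SIN_bound z). apply Rabs_le; lra.
Qed.

Lemma in_box_cos n b r th i j :
  in_box n b r th -> (i < n)%nat -> (j < n)%nat ->
  cos (b i - b j) - 2 * r <= cos (th i - th j) <= cos (b i - b j) + 2 * r.
Proof.
  intros H Hi Hj. pose proof (H i Hi) as H1. pose proof (H j Hj) as H2.
  pose proof (cos_lipschitz (th i - th j) (b i - b j)) as Hc.
  assert (Rabs (th i - th j - (b i - b j)) <= 2 * r).
  { apply Rabs_le_between in H1, H2. apply Rabs_le. lra. }
  assert (Hc' : Rabs (cos (th i - th j) - cos (b i - b j)) <= 2 * r) by lra.
  apply Rabs_le_between in Hc'. lra.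
Qed.

Lemma h2_close eps tau eta nu k x :
  0 < eps -> 0 <= nu -> sharp eps tau eta nu -> tau + eta <= k -> 0 <= k <= 1 ->
  k <= cos x -> h2 eps tau x <= 2 * nu - k.
Proof.
  intros He Hnu Hs Hk Hk1 Hx. unfold h2.
  destruct (proj1 (Hs (cos x)) ltac:(lra)) as [H1 H2].
  pose proof (dphi_range eps tau (cos x)). pose proof (ddphi_range eps tau (cos x) He).
  pose proof (sin2_cos2 x) as Hsc. unfold Rsqr in Hsc.
  assert (0 <= sin x * sin x <= 1) by nra.
  assert (ddphi eps tau (cos x) * (sin x * sin x) <= nu) by nra.
  assert (dphi eps tau (cos x) * k <= dphi eps tau (cos x) * cos x)
    by (apply Rmult_le_compat_l; lra).
  assert ((1 - nu) * k <= dphi eps tau (cos x) * k) by (apply Rmult_le_compat_r; lra).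
  nra.
Qed.

Lemma h2_far eps tau eta nu x :
  0 < eps -> 0 <= nu -> sharp eps tau eta nu -> cos x <= tau - eta -> h2 eps tau x <= 2 * nu.
Proof.
  intros He Hnu Hs Hx. unfold h2.
  destruct (proj2 (Hs (cos x)) Hx) as [H1 H2].
  pose proof (dphi_range eps tau (cos x)). pose proof (ddphi_range eps tau (cos x) He).
  pose proof (sin2_cos2 x) as Hsc. unfold Rsqr in Hsc. pose proof (COS_bound x).
  assert (0 <= sin x * sin x <= 1) by nra.
  assert (ddphi eps tau (cos x) * (sin x * sin x) <= nu) by nra.
  assert (- dphi eps tau (cos x) <= dphi eps tau (cos x) * cos x) by nra.
  lra.
Qed.

(** Inside the box each cosine moves by at most [2 * r], so close and far pairs stay on their sides
    of the window around [tau]. Every pair costs at most [2 * nu], close ones gain [p - 2 * r], and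
    the Poincare constant [M] spreads this gain over all pairs. *)
Lemma gap_concave eps tau eta nu n b r p q M mu :
  0 < eps -> 0 <= nu -> 0 < M -> sharp eps tau eta nu ->
  (forall i j, (i < n)%nat -> (j < n)%nat ->
     p <= cos (b i - b j) \/ cos (b i - b j) <= q) ->
  q + 2 * r + eta <= tau -> tau + eta <= p - 2 * r -> 0 <= p - 2 * r <= 1 ->
  (forall v, dispersion n v <= M * close_dispersion n b p v) ->
  mu <= (p - 2 * r) / M - 2 * nu ->
  concave_on_box eps tau n b r mu.
Proof.
  intros He Hnu HM Hs Hpq Hq Hp Hk Hgap Hmu th Hth v.
  apply Rle_trans with (2 * nu * dispersion n v + - (p - 2 * r) * close_dispersion n b p v).
  - unfold hessian, dispersion, close_dispersion.
    rewrite <- !sumR_scal, <- sumR_plus. apply sumR_le; intros i Hi.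
    rewrite <- !sumR_scal, <- sumR_plus. apply sumR_le; intros j Hj.
    pose proof (in_box_cos n b r th i j Hth Hi Hj) as Hc.
    pose proof (pow2_ge_0 (v i - v j)).
    destruct (Rle_dec p (cos (b i - b j))) as [Hcl|Hfa].
    + pose proof (h2_close eps tau eta nu (p - 2 * r) (th i - th j) He Hnu Hs Hp Hk ltac:(lra)).
      nra.
    + destruct (Hpq i j Hi Hj) as [|Hfar]; [easy|].
      pose proof (h2_far eps tau eta nu (th i - th j) He Hnu Hs ltac:(lra)). nra.
  - pose proof (dispersion_nonneg n v) as HD. specialize (Hgap v).
    assert (H1 : (p - 2 * r) / M * dispersion n v <= (p - 2 * r) * close_dispersion n b p v).
    { apply Rle_trans with ((p - 2 * r) / M * (M * close_dispersion n b p v)).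
      - apply Rmult_le_compat_l; [|easy].
        apply Rmult_le_pos; [easy|]. left; now apply Rinv_0_lt_compat.
      - right; field; lra. }
    nra.
Qed.

(** The centre [b] need not be critical: [f0] bounds its residual force and [f1 - f0] is the slack
    spent on a small box of starting points. The energy there is at most [INR n * f1 ^ 2], against a
    threshold quadratic in [INR n], so a fixed residual force is admissible for large [n]. *)
Lemma basin_pos_prob eps tau n b r mu f0 f1 :
  0 < eps -> (0 < n)%nat -> 0 < mu -> 0 < r <= 1 ->
  concave_on_box eps tau n b r mu ->
  (exists i j, (i < n)%nat /\ (j < n)%nat /\ cos (b i - b j) + 2 * r < 1) ->
  (forall i, (i < n)%nat -> Rabs (force eps tau n b i) <= f0) -> 0 <= f0 < f1 ->
  f1 ^ 2 <= INR n * (mu * (r / 4)) ^ 2 ->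
  pos_prob n (good_init eps tau n).
Proof.
  intros He Hn Hmu Hr Hcv (i & j & Hi & Hj & Hij) Hf0 Hf Hf1.
  pose proof (lt_0_INR n Hn) as Hn'.
  assert (Hie : 0 < / eps) by now apply Rinv_0_lt_compat.
  set (L := INR n * (2 * (/ eps + 1))). assert (HL : 0 < L) by (unfold L; nra).
  set (rho := Rmin (r / 4) ((f1 - f0) / L)).
  assert (Hrho : 0 < rho) by (apply Rmin_glb_lt; [lra|apply Rdiv_lt_0_compat; lra]).
  apply box_not_null with b rho; [exact Hrho|]. intros th Hth.
  apply (basin_good_init eps tau n b r mu); auto.
  - exists i, j. repeat split; auto. intros th' Hth'.
    pose proof (in_box_cos n b r th' i j Hth' Hi Hj). lra.
  - intros k Hk. eapply Rle_trans; [now apply Hth|apply Rmin_l].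
  - apply Rle_trans with (sumR n (fun _ => f1 ^ 2)).
    + apply sumR_le. intros k Hk. rewrite <- pow2_abs. apply pow_incr.
      split; [apply Rabs_pos|].
      pose proof (force_lipschitz eps tau n th b rho k He Hth Hk) as H1.
      assert (H2 : INR n * (2 * (/ eps + 1) * rho) <= f1 - f0).
      { replace (INR n * (2 * (/ eps + 1) * rho)) with (L * rho) by (unfold L; ring).
        apply Rle_trans with (L * ((f1 - f0) / L)).
        - apply Rmult_le_compat_l; [lra|apply Rmin_r].
        - right; field; lra. }
      pose proof (Rabs_triang (force eps tau n th k - force eps tau n b k)
                    (force eps tau n b k)) as H3.
      replace (force eps tau n th k - force eps tau n b k + force eps tau n b k)
        with (force eps tau n th k) in H3 by ring.
      specialize (Hf0 k Hk). lra.
    + rewrite sumR_const. replace ((mu * INR n * (r / 4)) ^ 2)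
        with (INR n * (INR n * (mu * (r / 4)) ^ 2)) by ring.
      apply Rmult_le_compat_l; lra.
Qed.

(** * Regular polygons and clusters *)

(** Defined for all indices: restricted to [i < c] it is the regular polygon, beyond that it winds
    around and gives [c] clusters indexed by [i mod c]. *)
Definition polygon (c : nat) (i : nat) : R := 2 * PI * INR i / INR c.

Lemma polygon_mod c i :
  (0 < c)%nat -> polygon c i = polygon c (i mod c) + 2 * INR (i / c) * PI.
Proof.
  intros Hc. pose proof (lt_0_INR c Hc) as Hc'. unfold polygon.
  rewrite (Nat.div_mod_eq i c) at 1. rewrite plus_INR, mult_INR. field. lra.
Qed.

Lemma cos_polygon_mod c i j :
  (0 < c)%nat ->
  cos (polygon c i - polygon c j) = cos (polygon c (i mod c) - polygon c (j mod c)).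
Proof.
  intros Hc. rewrite !cos_minus, (polygon_mod c i Hc), (polygon_mod c j Hc).
  now rewrite !cos_period, !sin_period.
Qed.

(** With truncated subtraction, [(i - j) + (j - i)] is the distance of [i] and [j]. *)
Lemma cos_polygon_dist c i j :
  cos (polygon c i - polygon c j) = cos (polygon c ((i - j) + (j - i))).
Proof.
  assert (H : forall i j, (j <= i)%nat -> polygon c i - polygon c j = polygon c (i - j)).
  { intros a b Hab. unfold polygon. rewrite minus_INR by easy. unfold Rdiv; ring. }
  destruct (Nat.le_ge_cases j i) as [Hle|Hle].
  - replace (j - i)%nat with 0%nat by lia. now rewrite Nat.add_0_r, H.
  - replace (i - j)%nat with 0%nat by lia. rewrite Nat.add_0_l, <- H by easy.
    rewrite <- cos_neg. f_equal; ring.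
Qed.

Lemma polygon_compl c k :
  (0 < c)%nat -> (k <= c)%nat -> cos (polygon c k) = cos (polygon c (c - k)).
Proof.
  intros Hc Hk. pose proof (lt_0_INR c Hc) as Hc'.
  replace (polygon c (c - k)) with (- polygon c k + 2 * INR 1 * PI).
  - now rewrite cos_period, cos_neg.
  - unfold polygon. rewrite minus_INR by easy. simpl. field. lra.
Qed.

(** An angle below a quarter turn satisfies [4 * k < c], and integrality improves this to
    [4 * k + 1 <= c]; the missing unit is the origin of [PI / (2 * INR c)] and of the cosine gap. *)
Lemma polygon_le c k : (0 < c)%nat -> (4 * k + 1 <= c)%nat ->
  0 <= polygon c k <= PI / 2 - PI / (2 * INR c).
Proof.
  intros Hc Hk. pose proof (lt_0_INR c Hc) as Hc'. pose proof PI_RGT_0.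
  apply le_INR in Hk. rewrite plus_INR, mult_INR in Hk. simpl in Hk.
  pose proof (pos_INR k). unfold polygon.
  assert (Hi : 0 < / INR c) by now apply Rinv_0_lt_compat.
  split; [apply Rmult_le_pos; nra|].
  replace (PI / 2 - PI / (2 * INR c)) with (PI * (INR c - 1) / 2 * / INR c) by (field; lra).
  apply Rmult_le_compat_r; nra.
Qed.

Lemma cos_polygon_close c k : (5 <= c)%nat -> (k < c)%nat ->
  (4 * k + 1 <= c \/ 3 * c + 1 <= 4 * k)%nat -> sin (PI / (2 * INR c)) <= cos (polygon c k).
Proof.
  intros Hc Hkc.
  assert (H : forall k, (4 * k + 1 <= c)%nat -> sin (PI / (2 * INR c)) <= cos (polygon c k)).
  { intros m Hm. destruct (polygon_le c m) as [H1 H2]; [lia|easy|].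
    rewrite <- cos_shift. pose proof PI_RGT_0.
    assert (0 < PI / (2 * INR c)).
    { apply Rdiv_lt_0_compat; [lra|]. assert (0 < INR c) by (apply lt_0_INR; lia). lra. }
    apply cos_decr_1; lra. }
  intros [Hk|Hk]; [auto|]. rewrite polygon_compl by lia. apply H; lia.
Qed.

Lemma cos_polygon_far c k : (0 < c)%nat -> (c <= 4 * k <= 3 * c)%nat -> cos (polygon c k) <= 0.
Proof.
  intros Hc [H1 H2]. pose proof (lt_0_INR c Hc) as Hc'. pose proof PI_RGT_0.
  apply le_INR in H1, H2. rewrite !mult_INR in *. simpl in H1, H2.
  assert (Hi : 0 < / INR c) by now apply Rinv_0_lt_compat.
  unfold polygon. apply cos_le_0.
  - replace (PI / 2) with (PI * INR c / 2 * / INR c) by (field; lra).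
    apply Rmult_le_compat_r; nra.
  - replace (3 * (PI / 2)) with (3 * (PI * INR c) / 2 * / INR c) by (field; lra).
    apply Rmult_le_compat_r; nra.
Qed.

(** The bound is strictly negative, unlike the bound 0 for general polygons. This margin is needed
    because [tau] may be much smaller than the radius of the cluster box. *)
Lemma cos_pentagon_far k : k = 2%nat \/ k = 3%nat -> cos (polygon 5 k) <= - sin (PI / 10).
Proof.
  assert (H : cos (polygon 5 2) <= - sin (PI / 10)).
  { pose proof PI_RGT_0. unfold polygon. simpl INR.
    replace (- sin (PI / 10)) with (cos (PI / 10 + PI / 2)).
    - apply cos_decr_1; lra.
    - rewrite cos_plus, cos_PI2, sin_PI2. ring. }
  intros [->| ->]; [exact H|]. rewrite polygon_compl by lia. exact H.
Qed.

Lemma h1_period eps tau x k : h1 eps tau (x + 2 * INR k * PI) = h1 eps tau x.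
Proof. unfold h1. now rewrite cos_period, sin_period. Qed.

(* All forces on a regular polygon agree by rotation, and they sum to zero. *)
Lemma polygon_force eps tau c i : (0 < c)%nat -> force eps tau c (polygon c) i = 0.
Proof.
  intros Hc. pose proof (lt_0_INR c Hc) as Hc'.
  assert (Hs : forall i, force eps tau c (polygon c) (S i) = force eps tau c (polygon c) i).
  { intros k. unfold force. destruct c as [|c]; [lia|].
    (* Shifting the summation index by one matches all terms but one on each side: term 0 on the
       left and the last term on the right differ by a full turn. *)
    change (S c) with (1 + c)%nat at 1. rewrite sumR_split. simpl.
    rewrite Rplus_0_l, Rplus_comm. f_equal.
    - apply sumR_ext. intros j _. f_equal. unfold polygon.
      rewrite !(S_INR k), !(S_INR j). field. lra.
    - rewrite <- (h1_period eps tau (_ - polygon (S c) c) 1). f_equal.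
      unfold polygon. rewrite !S_INR in *. simpl. field. lra. }
  assert (He : forall i, force eps tau c (polygon c) i = force eps tau c (polygon c) 0).
  { induction i0 as [|k IH]; [easy|now rewrite Hs]. }
  pose proof (force_sum eps tau c (polygon c)) as H0.
  rewrite (sumR_ext c _ (fun _ => force eps tau c (polygon c) 0)), sumR_const in H0 by auto.
  rewrite He. apply Rmult_integral in H0. lra.
Qed.

(** Each complete block of five is a regular pentagon and exerts no force on any of its vertices; at
    most four points are left over, each contributing at most 1. *)
Lemma cluster_force eps tau n i : Rabs (force eps tau n (polygon 5) i) <= 4.
Proof.
  induction n as [n IH] using (well_founded_induction Wf_nat.lt_wf).
  destruct (Nat.lt_ge_cases n 5) as [Hn|Hn].
  - eapply Rle_trans; [apply force_bound|]. replace 4 with (INR 4) by (simpl; ring).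
    apply le_INR; lia.
  - replace n with (5 + (n - 5))%nat by lia. unfold force. rewrite sumR_split.
    fold (force eps tau 5 (polygon 5) i). rewrite polygon_force, Rplus_0_l by lia.
    rewrite (sumR_ext _ _ (fun j => h1 eps tau (polygon 5 i - polygon 5 j))).
    + apply (IH (n - 5)%nat). lia.
    + intros j _. rewrite <- (h1_period eps tau (_ - polygon 5 (5 + j)) 1). f_equal.
      unfold polygon. rewrite plus_INR. simpl INR. field.
Qed.

Lemma polygon_gap n p v :
  (5 <= n)%nat -> p <= sin (PI / (2 * INR n)) ->
  dispersion n v <= INR n ^ 4 * close_dispersion n (polygon n) p v.
Proof.
  intros Hn Hp. set (D := close_dispersion n (polygon n) p v).
  set (g := fun i j => if Rle_dec p (cos (polygon n i - polygon n j)) then (v i - v j) ^ 2 else 0).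
  assert (Hg : forall i j, 0 <= g i j).
  { intros i j. unfold g. destruct (Rle_dec _ _); [apply pow2_ge_0|lra]. }
  assert (HD : 0 <= D).
  { apply sumR_nonneg; intros i _. apply sumR_nonneg; intros j _. apply Hg. }
  set (s := sqrt D). assert (Hs : 0 <= s) by apply sqrt_pos.
  assert (Hss : s * s = D) by now apply sqrt_sqrt.
  assert (Hstep : forall i, (S i < n)%nat -> Rabs (v (S i) - v i) <= s).
  { intros i Hi. apply Rsqr_incr_0_var; [|easy]. rewrite <- Rsqr_abs.
    unfold Rsqr. rewrite Hss.
    apply Rle_trans with (g (S i) i).
    - unfold g. destruct (Rle_dec _ _) as [|Hno]; [right; ring|].
      exfalso; apply Hno. eapply Rle_trans; [exact Hp|].
      rewrite cos_polygon_dist. replace (S i - i + (i - S i))%nat with 1%nat by lia.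
      apply cos_polygon_close; lia.
    - eapply Rle_trans; [apply (sumR_term_le n (g (S i)) i); auto; lia|].
      apply (sumR_term_le n (fun i => sumR n (g i)) (S i)); [|easy].
      intros; now apply sumR_nonneg. }
  assert (Hpath : forall i, (i < n)%nat -> forall m, (i + m < n)%nat ->
            Rabs (v (i + m)%nat - v i) <= INR m * s).
  { intros i Hi. induction m as [|m IH]; intros Hm.
    - rewrite Nat.add_0_r, Rminus_diag, Rabs_R0. simpl; lra.
    - rewrite S_INR, Nat.add_succ_r.
      pose proof (IH ltac:(lia)) as H1. pose proof (Hstep (i + m)%nat ltac:(lia)) as H2.
      replace (v (S (i + m)) - v i) with ((v (S (i + m)) - v (i + m)%nat) + (v (i + m)%nat - v i))
        by ring.
      eapply Rle_trans; [apply Rabs_triang|]. lra. }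
  assert (Hpair : forall i j, (i < n)%nat -> (j < n)%nat -> (v i - v j) ^ 2 <= INR n ^ 2 * D).
  { assert (Hw : forall i j, (i <= j)%nat -> (j < n)%nat -> (v j - v i) ^ 2 <= INR n ^ 2 * D).
    { intros i j Hij Hj. rewrite <- Hss. replace (INR n ^ 2 * (s * s)) with ((INR n * s) ^ 2) by ring.
      rewrite <- pow2_abs. apply pow_incr. split; [apply Rabs_pos|].
      pose proof (Hpath i ltac:(lia) (j - i)%nat ltac:(lia)) as H1.
      replace (i + (j - i))%nat with j in H1 by lia.
      eapply Rle_trans; [exact H1|]. apply Rmult_le_compat_r; [easy|]. apply le_INR; lia. }
    intros i j Hi Hj. destruct (Nat.le_ge_cases i j).
    - replace ((v i - v j) ^ 2) with ((v j - v i) ^ 2) by ring. now apply Hw.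
    - now apply Hw. }
  unfold dispersion. apply Rle_trans with (sumR n (fun _ => sumR n (fun _ => INR n ^ 2 * D))).
  - apply sumR_le; intros i Hi. apply sumR_le; intros j Hj. now apply Hpair.
  - rewrite !sumR_const. right; ring.
Qed.

Lemma count_residue n c :
  (c < 5)%nat -> (INR n - 4) / 5 <= sumR n (fun k => if Nat.eqb (k mod 5) c then 1 else 0).
Proof.
  intros Hc. induction n as [n IH] using (well_founded_induction Wf_nat.lt_wf).
  destruct (Nat.lt_ge_cases n 5) as [Hn|Hn].
  - apply Rle_trans with 0.
    + assert (INR n <= 4); [|lra]. replace 4 with (INR 4) by (simpl; ring). apply le_INR; lia.
    + apply sumR_nonneg. intros k _. destruct (Nat.eqb _ _); lra.
  - specialize (IH (n - 5)%nat ltac:(lia)). rewrite minus_INR in IH by easy. simpl INR in IH.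
    replace n with (5 + (n - 5))%nat at 2 by lia. rewrite sumR_split.
    rewrite (sumR_ext (n - 5) _ (fun k => if Nat.eqb (k mod 5) c then 1 else 0)).
    + assert (H5 : sumR 5 (fun k => if Nat.eqb (k mod 5) c then 1 else 0) = 1).
      { do 5 (destruct c as [|c]; [simpl; lra|]). lia. }
      rewrite H5. lra.
    + intros j _. replace (5 + j)%nat with (j + 1 * 5)%nat by lia. now rewrite Nat.Div0.mod_add.
Qed.

Lemma pentagon_close i j : (i < 5)%nat -> (j < 5)%nat ->
  (i - j + (j - i) <= 1 \/ i - j + (j - i) = 4)%nat ->
  sin (PI / 10) <= cos (polygon 5 i - polygon 5 j).
Proof.
  intros Hi Hj Hd. rewrite cos_polygon_dist.
  replace (PI / 10) with (PI / (2 * INR 5)) by (simpl; field).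
  apply cos_polygon_close; lia.
Qed.

Lemma cluster_dichotomy i j :
  sin (PI / 10) <= cos (polygon 5 i - polygon 5 j) \/
  cos (polygon 5 i - polygon 5 j) <= - sin (PI / 10).
Proof.
  rewrite cos_polygon_mod by lia.
  pose proof (Nat.mod_upper_bound i 5 ltac:(lia)) as Hi.
  pose proof (Nat.mod_upper_bound j 5 ltac:(lia)) as Hj.
  set (a := (i mod 5)%nat) in *. set (c := (j mod 5)%nat) in *.
  destruct (Nat.eq_dec (a - c + (c - a)) 2) as [H2|H2];
    [right; rewrite cos_polygon_dist; apply cos_pentagon_far; lia|].
  destruct (Nat.eq_dec (a - c + (c - a)) 3) as [H3|H3];
    [right; rewrite cos_polygon_dist; apply cos_pentagon_far; lia|].
  left. apply pentagon_close; lia.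
Qed.

(* Any two clusters have a common neighbour, through which the spread of a distant
   pair is controlled. *)
Lemma cluster_gap n v :
  (10 <= n)%nat ->
  dispersion n v <= 40 * close_dispersion n (polygon 5) (sin (PI / 10)) v.
Proof.
  intros Hn. set (p := sin (PI / 10)).
  set (g := fun i j => if Rle_dec p (cos (polygon 5 i - polygon 5 j)) then (v i - v j) ^ 2 else 0).
  set (D := sumR n (fun i => sumR n (fun j => g i j))).
  change (close_dispersion n (polygon 5) p v) with D.
  assert (Hg : forall i j, 0 <= g i j).
  { intros i j. unfold g. destruct (Rle_dec _ _); [apply pow2_ge_0|lra]. }
  assert (Hn' : 10 <= INR n).
  { replace 10 with (INR 10) by (simpl; ring). now apply le_INR. }
  (* [INR n / 10] bounds from below the size [(INR n - 4) / 5] of the smallest cluster once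
     [n >= 10]. Each [k] in the common neighbour contributes through
     [(x + y) ^ 2 <= 2 * (x ^ 2 + y ^ 2)]. *)
  assert (Hpair : forall i j, INR n / 10 * (v i - v j) ^ 2
                    <= sumR n (fun k => 2 * (g i k + g k j))).
  { intros i j.
    assert (Hmid : exists c, (c < 5)%nat /\ forall k, (k mod 5 = c)%nat ->
              p <= cos (polygon 5 i - polygon 5 k) /\ p <= cos (polygon 5 k - polygon 5 j)).
    { pose proof (Nat.mod_upper_bound i 5 ltac:(lia)) as Hi.
      pose proof (Nat.mod_upper_bound j 5 ltac:(lia)) as Hj.
      set (a := (i mod 5)%nat) in *. set (d := (j mod 5)%nat) in *.
      assert (Hc : exists c, (c < 5)%nat /\
                (a - c + (c - a) <= 1 \/ a - c + (c - a) = 4)%nat /\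
                (c - d + (d - c) <= 1 \/ c - d + (d - c) = 4)%nat).
      (* On the 5-cycle, residues at distance 2 have the one in between as common neighbour. At
         difference 3 the short way passes through the wrap-around, via 4 for the pair 0, 3 and via
         0 for the pair 1, 4. Otherwise [a] itself serves. *)
      { destruct (Nat.eq_dec (a - d + (d - a)) 2);
          [exists (S (Nat.min a d)); lia|].
        destruct (Nat.eq_dec (a - d + (d - a)) 3); [|exists a; lia].
        destruct (Nat.eq_dec (Nat.min a d) 0); [exists 4%nat; lia|exists 0%nat; lia]. }
      destruct Hc as (c & Hc & H1 & H2). exists c. split; [easy|]. intros k Hk.
      rewrite (cos_polygon_mod 5 i k), (cos_polygon_mod 5 k j) by lia. rewrite Hk.
      fold a d. split; now apply pentagon_close. }
    destruct Hmid as (c & Hc & Hmid).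
    apply Rle_trans with
      (sumR n (fun k => (v i - v j) ^ 2 * (if Nat.eqb (k mod 5) c then 1 else 0))).
    - rewrite sumR_scal. pose proof (count_residue n c Hc).
      pose proof (pow2_ge_0 (v i - v j)). rewrite Rmult_comm.
      apply Rmult_le_compat_l; lra.
    - apply sumR_le. intros k _. pose proof (Hg i k). pose proof (Hg k j).
      destruct (Nat.eqb_spec (k mod 5) c) as [Hk|Hk]; [|lra].
      destruct (Hmid k Hk) as [H1 H2]. unfold g.
      destruct (Rle_dec p (cos (polygon 5 i - polygon 5 k))) as [_|]; [|easy].
      destruct (Rle_dec p (cos (polygon 5 k - polygon 5 j))) as [_|]; [|easy].
      pose proof (pow2_ge_0 ((v i - v k) - (v k - v j))). nra. }
  assert (Hsum : INR n / 10 * dispersion n v <= 4 * INR n * D).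
  { apply Rle_trans with
      (sumR n (fun i => sumR n (fun j => sumR n (fun k => 2 * (g i k + g k j))))).
    - unfold dispersion. rewrite <- sumR_scal. apply sumR_le; intros i _.
      rewrite <- sumR_scal. apply sumR_le; intros j _. apply Hpair.
    - right.
      rewrite (sumR_ext n _ (fun i => 2 * (INR n * sumR n (fun k => g i k) + D))).
      + rewrite sumR_scal, sumR_plus, sumR_scal, sumR_const. fold D. ring.
      + intros i _. rewrite sumR_swap.
        rewrite (sumR_ext n _ (fun k => 2 * (INR n * g i k + sumR n (fun j => g k j)))).
        * rewrite sumR_scal, sumR_plus, sumR_scal. reflexivity.
        * intros k _. now rewrite sumR_scal, sumR_plus, sumR_const. }
  nra.
Qed.

(** * Choice of the constants *)

Lemma cluster_pos_prob eps tau eta nu n :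
  0 < eps -> sharp eps tau eta nu -> 0 < tau -> 0 < nu ->
  let p := sin (PI / 10) in
  tau <= p / 2 -> eta <= p / 4 -> 4 * nu <= 3 * p / 160 ->
  (10 <= n)%nat -> 25 <= INR n * (3 * p / 320 * (p / 32)) ^ 2 ->
  pos_prob n (good_init eps tau n).
Proof.
  intros He Hs Ht Hnu p Htp Hep Hnp Hn Hbig.
  assert (Hp : 0 < p <= 1).
  { unfold p. split; [|apply SIN_bound]. pose proof PI_RGT_0. apply sin_gt_0; lra. }
  (* Radius [p / 8] leaves close cosines above [3 * p / 4]; dividing by the Poincare constant 40 and
     giving half of the result to the error [2 * nu] yields [3 * p / 320]. The residual force 4 is
     rounded up to 5 for slack. *)
  apply (basin_pos_prob eps tau n (polygon 5) (p / 8) (3 * p / 320) 4 5); try lra; try lia.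
  - apply (gap_concave eps tau eta nu n (polygon 5) (p / 8) p (- p) 40); try lra; try easy.
    + intros i j _ _. apply cluster_dichotomy.
    + intros v. now apply cluster_gap.
  - exists 2%nat, 0%nat. split; [lia|split; [lia|]].
    rewrite cos_polygon_dist. change (2 - 0 + (0 - 2))%nat with 2%nat.
    pose proof (cos_pentagon_far 2 ltac:(now left)). fold p in H. lra.
  - intros i _. apply cluster_force.
Qed.

Lemma polygon_pos_prob eps s nu N n :
  0 < eps -> 0 < s -> 0 < nu -> (5 <= n < N)%nat -> s <= sin (PI / (2 * INR n)) ->
  sharp eps (s / 2) (s / 4) nu -> 4 * nu <= 3 * s / 4 / INR N ^ 4 ->
  pos_prob n (good_init eps (s / 2) n).
Proof.
  intros He Hs Hnu Hn Hsn Hsh HnN.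
  pose proof (SIN_bound (PI / (2 * INR n))) as Hsb.
  assert (Hn' : 0 < INR n) by (apply lt_0_INR; lia).
  assert (HnN' : INR n <= INR N) by (apply le_INR; lia).
  assert (HM : 0 < INR N ^ 4) by (apply pow_lt; lra).
  set (mu := 3 * s / 4 / INR N ^ 4 - 2 * nu).
  (* The bound on [nu] lets the error [2 * nu] consume at most half of the concavity. *)
  assert (Hmu : 0 < mu) by (unfold mu; lra).
  set (f := mu * (s / 8 / 4)). assert (Hf : 0 < f) by (unfold f; nra).
  apply (basin_pos_prob eps (s / 2) n (polygon n) (s / 8) mu 0 f); try lra; try lia.
  - apply (gap_concave eps (s / 2) (s / 4) nu n (polygon n) (s / 8) s 0 (INR N ^ 4)); try lra;
      try easy.
    + intros i j Hi Hj. rewrite cos_polygon_dist.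
      set (k := (i - j + (j - i))%nat). assert (Hk : (k < n)%nat) by (unfold k; lia).
      destruct (Nat.le_gt_cases n (4 * k)) as [H1|H1].
      * destruct (Nat.le_gt_cases (4 * k) (3 * n)) as [H2|H2].
        -- right. apply cos_polygon_far; lia.
        -- left. eapply Rle_trans; [exact Hsn|]. apply cos_polygon_close; lia.
      * left. eapply Rle_trans; [exact Hsn|]. apply cos_polygon_close; lia.
    + intros v. eapply Rle_trans; [apply (polygon_gap n s v); [lia|easy]|].
      apply Rmult_le_compat_r.
      * apply sumR_nonneg; intros i _. apply sumR_nonneg; intros j _.
        destruct (Rle_dec _ _); [apply pow2_ge_0|lra].
      * apply pow_incr; lra.
    + unfold mu. right. field. lra.
  - exists (n / 2)%nat, 0%nat.
    assert (H2 : (n / 2 < n)%nat) by (apply Nat.div_lt; lia).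
    split; [easy|split; [lia|]]. rewrite cos_polygon_dist, Nat.sub_0_r, Nat.add_0_r.
    pose proof (Nat.div_mod_eq n 2) as Hdm.
    pose proof (Nat.mod_upper_bound n 2 ltac:(lia)).
    pose proof (cos_polygon_far n (n / 2) ltac:(lia) ltac:(lia)). lra.
  - intros i _. rewrite polygon_force by lia. rewrite Rabs_R0. lra.
  - fold f. assert (1 <= INR n) by (change 1 with (INR 1); apply le_INR; lia).
    pose proof (pow2_ge_0 f). nra.
Qed.

Theorem mainTheorem3 :
  exists eps tau : R, 0 < eps /\ -1 < tau < 1 /\
    forall n : nat, (5 <= n)%nat ->
      pos_prob n (good_init eps tau n).
Proof.
  pose proof PI_RGT_0 as Hpi.
  set (p := sin (PI / 10)).
  assert (Hp : 0 < p) by (apply sin_gt_0; lra).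
  set (C := (3 * p / 320 * (p / 32)) ^ 2).
  assert (HC : 0 < C) by (apply pow_lt, Rmult_lt_0_compat; lra).
  (* 25 is the square of the force bound 5 used for the clusters. [C] involves only [p], so [N] is
     fixed before [tau], [nu] and [eps]. *)
  destruct (INR_unbounded (25 / C)) as [N0 HN0].
  set (N := (N0 + 10)%nat).
  assert (HN0' : INR N0 <= INR N) by (apply le_INR; unfold N; lia).
  assert (HN10 : INR 10 <= INR N) by (apply le_INR; unfold N; lia).
  assert (HM : 0 < INR N ^ 4) by (apply pow_lt; simpl in HN10; lra).
  set (s := sin (PI / (2 * INR N))).
  assert (Hs : forall n, (5 <= n <= N)%nat -> 0 < s <= sin (PI / (2 * INR n))).
  { intros n Hn.
    assert (H5 : INR 5 <= INR n) by (apply le_INR; lia).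
    assert (HnN : INR n <= INR N) by (apply le_INR; lia). simpl in H5.
    assert (H1 : 0 < PI / (2 * INR N)) by (apply Rdiv_lt_0_compat; lra).
    assert (H2 : PI / (2 * INR N) <= PI / (2 * INR n)).
    { apply Rmult_le_compat_l; [lra|]. apply Rinv_le_contravar; lra. }
    assert (H3 : PI / (2 * INR n) <= PI / 10).
    { apply Rmult_le_compat_l; [lra|]. apply Rinv_le_contravar; lra. }
    split; [apply sin_gt_0; lra|]. apply sin_incr_1; lra. }
  (* This makes [tau = s / 2] and [eta = s / 4] admissible for the clusters as well. *)
  assert (Hs5 : 0 < s <= p).
  { replace p with (sin (PI / (2 * INR 5))) by (unfold p; f_equal; simpl; field).
    apply Hs. unfold N; lia. }
  pose proof (SIN_bound (PI / 10)) as Hp1. fold p in Hp1.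
  (* The two entries are the error tolerances of the cluster range and of the polygon range, so one
     [eps] serves both. *)
  set (nu := Rmin (3 * p / 640) (3 * s / 16 / INR N ^ 4)).
  assert (Hnu1 : nu <= 3 * p / 640) by apply Rmin_l.
  assert (Hnu2 : nu <= 3 * s / 16 / INR N ^ 4) by apply Rmin_r.
  assert (Hnu : 0 < nu) by (apply Rmin_glb_lt; [lra|apply Rdiv_lt_0_compat; lra]).
  destruct (softplus_sharp (s / 4) nu ltac:(lra) Hnu) as (eps & He & Hsh).
  exists eps, (s / 2). split; [easy|]. split; [lra|]. intros n Hn.
  destruct (Nat.lt_ge_cases n N) as [HnN|HnN].
  - apply (polygon_pos_prob eps s nu N n); auto; try lra.
    apply Hs; lia.
  - apply (cluster_pos_prob eps (s / 2) (s / 4) nu n); auto; fold p; try lra.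
    + unfold N in HnN; lia.
    + fold C. apply le_INR in HnN.
      assert (25 / C * C <= INR n * C) by (apply Rmult_le_compat_r; lra).
      replace (25 / C * C) with 25 in H by (field; lra). exact H.
Qed.
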